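(* Let $W$ be a normal integral scheme essentially of finite type over $\mathbb{C}$. The following conditions are equivalent. (1) $W$ has valuative log canonical singularities. (2) For any birational model $\pi : W_\pi \to W$ and any positive integer $m$, $$\pi_* \mathcal{O}_{W_\pi}\bigl(m(K_{W_\pi} + E^\pi)\bigr) = \mathcal{O}_W(mK_W),$$ where $E^\pi$ is the sum of the $\pi$-exceptional prime divisors on $W_\pi$. Furthermore, if $W$ has a log canonical model, then (1) and (2) are also equivalent to the following condition. (3) The log canonical model of $W$ is an isomorphism in codimension one.
   Context: A birational model of $W$ is a projective birational morphism $\pi : W_\pi \to W$ with $W_\pi$ normal. A prime divisor over $W$ is a prime divisor $E$ on some birational model of $W$ (identified with its divisorial valuation $\operatorname{ord}_E$). An $\mathbb{R}$-Weil $b$-divisor over $W$ is a family $B=(B_\pi)_\pi$ of $\mathbb{R}$-Weil divisors $B_\pi$ on $W_\pi$, one for each birational model, compatible under push-forward; $\operatorname{ord}_E(B)$ is the coefficient of $E$ in $B_\pi$ for any model on which $E$ is a divisor, and $B \ge B'$ means $\operatorname{ord}_E(B)\ge \operatorname{ord}_E(B')$ for all prime divisors $E$ over $W$. Fix a canonical divisor $K_W$ (the divisor of a nonzero rational top differential form); $K_{W_\pi}$ is the canonical divisor of $W_\pi$ defined by the same form, and $K_{\mathfrak W}$ is the $b$-divisor $(K_{W_\pi})_\pi$. Let $1_{\mathfrak W/W}$ be the $b$-divisor whose trace on $W_\pi$ is $E^\pi$. For a nonzero coherent fractional ideal sheaf $\mathfrak a$ on $W$, $Z(\mathfrak a)$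 is the $b$-divisor with $\operatorname{ord}_E Z(\mathfrak a) = -\min\{\operatorname{ord}_E(g)\}$, the minimum over local sections $g$ of $\mathfrak a$ at the generic point of the center of $E$. For an $\mathbb{R}$-Weil divisor $D$ on $W$, the nef envelope $\mathrm{Env}_W(D)$ is the $b$-divisor $\lim_{m\to\infty}\frac1m Z(\mathcal{O}_W(mD))$ (coefficientwise limit). Set $\mathrm{A}^+_{\mathfrak W/W} := K_{\mathfrak W}+1_{\mathfrak W/W}-\mathrm{Env}_W(K_W)$. $W$ has valuative log canonical singularities if $\mathrm{A}^+_{\mathfrak W/W}\ge 0$. A log canonical model of $W$ is a birational model $\mu: Y \to W$ such that $K_Y+E^\mu$ is $\mathbb{Q}$-Cartier and $\mu$-ample and the pair $(Y,E^\mu)$ is log canonical, where $E^\mu$ is the sum of the $\mu$-exceptional prime divisors. It is an isomorphism in codimension one if there are no $\mu$-exceptional prime divisors. *)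

(* Defs.v *)
From HB Require Import structures.
From mathcomp Require Import all_boot all_order all_algebra.
From mathcomp Require Import complex.
From mathcomp Require Import all_classical all_reals all_analysis.

Set Implicit Arguments.
Unset Strict Implicit.
Unset Printing Implicit Defensive.
Import Order.TTheory GRing.Theory Num.Theory.
Import numFieldNormedType.Exports.
Local Open Scope classical_set_scope.
Local Open Scope ring_scope.

(** * Conventions

    All the schemes involved are integral and birational to one another, so
    they are described inside a single function field [K].  The structure sheaf
    of an integral scheme [X] with function field [K] is a sheaf of subrings of
    the constant sheaf [K]: [O_X(U)] is the intersection of the local rings
    [O_{X,x}], [x] in [U].  Hence [X] is given by a topological space together
    with the subring [O_{X,x}] of [K] attached to each point, subject to the
    requirement of being locally isomorphic to the spectrum of a ring.

    A birational morphism [pi : Y -> X] is used to identify the function fields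
    of [Y] and [X]; the comorphisms [O_{X,pi y} -> O_{Y,y}] are then inclusions
    of subrings of [K].

    The complex numbers are [R[i]], for [R] a model of the real numbers.  The
    function field is a [C]-algebra through [iota : R[i] -> K]. *)

Section Subrings.
Variable K : fieldType.
Implicit Types (A O P S G M : set K) (f g t u : K).

Definition subring A :=
  [/\ A 1, forall f g, A f -> A g -> A (f - g)
         & forall f g, A f -> A g -> A (f * g)].

Definition submodule A M :=
  [/\ M 0, forall f g, M f -> M g -> M (f + g)
         & forall a f, A a -> M f -> M (a * f)].

Definition prime_ideal A P :=
  [/\ P `<=` A, submodule A P, ~ P 1
    & forall f g, A f -> A g -> P (f * g) -> P f \/ P g].

Definition adjoin A G : set K := smallest subring (A `|` G).

Definition span A G : set K := smallest (submodule A) G.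

Definition fractions A S : set K := [set a / s | a in A & s in S].

Definition localization A P : set K := fractions A (A `\` P).

Definition unit_of A u := [/\ u != 0, A u & A u^-1].

(* The maximal ideal of [A] when [A] is a local ring. *)
Definition nonunits A : set K := A `\` unit_of A.

Definition integrally_closed A :=
  forall (f : K) (p : {poly K}),
    p \is monic -> (forall i, A p`_i) -> root p f -> A f.

(* [O] is a local ring of Krull dimension 1. *)
Definition dim1 O :=
  nonunits O <> [set 0] /\
  forall P, prime_ideal O P -> P = [set 0] \/ P = nonunits O.

Definition uniformizer O t := O t /\ nonunits O = [set t * a | a in O].

(* The normalized valuation of a discrete valuation ring [O] at [f != 0];
   the value at [f = 0] is irrelevant and never used. *)
Definition ord O f : int :=
  xget 0 [set k : int |
    exists t u, [/\ uniformizer O t, unit_of O u & f = u * t ^ k]].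

End Subrings.

(** * Integral schemes with function field [K] *)

Section IntegralSchemes.
Variable K : fieldType.

Definition sections_of (X : Type) (stalk : X -> set K) (U : set X) : set K :=
  [set f | forall x, U x -> stalk x f].

(* [U] is open and, with [A := O(U)], [x |-> m_x `&` A] is an isomorphism of
   ringed spaces from [U] onto [Spec A].  The open subsets of [Spec A] are the
   sets of primes not containing a given subset [I] of [A]. *)
Definition affine_on (X : topologicalType) (stalk : X -> set K) (U : set X) :=
  let A := sections_of stalk U in
  let centre x := nonunits (stalk x) `&` A in
  [/\ open U,
      fractions A (A `\ 0) = setT,
      forall x, U x ->
        prime_ideal A (centre x) /\ stalk x = localization A (centre x),
      forall P, prime_ideal A P -> exists! x, U x /\ centre x = P
    & forall V : set X, V `<=` U ->
        (open V <-> exists2 I, I `<=` A &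
                    V = [set x | U x /\ ~ (I `<=` centre x)])].

Record int_scheme := IntScheme {
  points :> topologicalType;
  stalk : points -> set K;
  stalk_subring : forall x, subring (stalk x);
  points_inhabited : exists x : points, True;
  points_irreducible : forall U V : set points,
    open U -> open V -> U !=set0 -> V !=set0 -> U `&` V !=set0;
  affine_cover : forall x, exists2 U, affine_on stalk U & U x
}.

Definition sections (X : int_scheme) (U : set X) : set K :=
  sections_of (@stalk X) U.

Definition affine_open (X : int_scheme) (U : set X) :=
  affine_on (@stalk X) U.

Definition normal (X : int_scheme) :=
  forall x : X, integrally_closed (stalk x).

(* Points of codimension one correspond to prime divisors, a prime divisor
   being identified with its generic point. *)
Definition codim1 (X : int_scheme) (x : X) := dim1 (stalk x).

Record pdiv (X : int_scheme) := PDiv {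
  gpoint :> X;
  gpoint_codim1 : codim1 gpoint
}.

(* Only divisors on normal schemes are considered. *)
Definition wdiv (R : realType) (X : int_scheme) := pdiv X -> R.

Definition birational_morphism (Y X : int_scheme) (pi : Y -> X) :=
  continuous pi /\
  forall y, stalk (pi y) `<=` stalk y /\
            nonunits (stalk (pi y)) `<=` nonunits (stalk y).

(* Submodules of the constant sheaf [K], given by their stalks. *)
Definition frac_sheaf (X : int_scheme) := X -> set K.

Definition coherent (X : int_scheme) (J : frac_sheaf X) :=
  forall x, exists (U : set X) (s : seq K),
    [/\ open U, U x & forall y, U y -> J y = span (stalk y) [set` s]].

(* The locus over [V] where [g] generates the module spanned by [s]. *)
Definition chart (Y X : int_scheme) (pi : Y -> X) (V : set X) (s : seq K)
  (g : K) : set Y := [set y | V (pi y) /\ forall h, h \in s -> stalk y (h / g)].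

(* [pi] factors through a closed immersion over [X] into the projective bundle
   [P(J)] of a coherent sheaf [J].  Since [Y] is integral and birational to
   [X], the tautological invertible quotient of the pull-back of [J] embeds in
   [K], so replacing [J] by its image in [K] one may take [J] to be a fractional
   ideal sheaf.  Over an affine open [V] where [J] is generated by
   [s = (g_0, ..., g_N)], the morphism is [y |-> [g_0 : ... : g_N]] from
   [pi^{-1}(V)] to [P^N_V]; it is everywhere defined and is a closed immersion
   iff the preimages of the standard charts [g != 0] cover, are affine, and have
   [O(V)[h/g : h in s]] as ring of functions. *)
Definition projective (Y X : int_scheme) (pi : Y -> X) :=
  exists2 J : frac_sheaf X, coherent J &
  forall x, exists (V : set X) (s : seq K),
    [/\ affine_open V /\ V x,
        forall x', V x' -> J x' = span (stalk x') [set` s],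
        forall g, g \in s -> g != 0 ->
          affine_open (chart pi V s g) /\
          sections (chart pi V s g) =
            adjoin (sections V) [set h / g | h in [set` s]]
      & forall y, V (pi y) -> exists g, [/\ g \in s, g != 0 & chart pi V s g y]].

Record model (W : int_scheme) := Model {
  mscheme :> int_scheme;
  mnormal : normal mscheme;
  mmap : mscheme -> W;
  mmap_birational : birational_morphism mmap;
  mmap_projective : projective mmap
}.

(* [E] is exceptional iff its image has codimension at least two. *)
Definition exceptional (W : int_scheme) (M : model W) (E : pdiv M) :=
  ~ codim1 (mmap (E : M)).

Definition iso_in_codim1 (W : int_scheme) (M : model W) :=
  forall E : pdiv M, ~ exceptional E.

End IntegralSchemes.

(** * Divisorial sheaves on normal schemes *)

Section Divisors.
Variables (K : fieldType) (R : realType).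

Definition div_sections (X : int_scheme K) (D : wdiv R X) (U : set X) : set K :=
  [set f | f = 0 \/
    forall E : pdiv X, U E -> 0 <= (ord (stalk (E : X)) f)%:~R + D E].

Definition div_stalk (X : int_scheme K) (D : wdiv R X) : frac_sheaf X :=
  fun x => [set f | exists U : set X, [/\ open U, U x & div_sections D U f]].

Definition wscale (X : int_scheme K) (m : nat) (D : wdiv R X) : wdiv R X :=
  fun E => m%:R * D E.

Definition wadd (X : int_scheme K) (D D' : wdiv R X) : wdiv R X :=
  fun E => D E + D' E.

(* [D] is the divisor of [h] in a neighbourhood of [x]. *)
Definition local_equation (X : int_scheme K) (D : wdiv R X) (x : X) (h : K) :=
  h != 0 /\ exists U : set X, [/\ open U, U x &
    forall E : pdiv X, U E -> D E = (ord (stalk (E : X)) h)%:~R].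

Definition cartier (X : int_scheme K) (D : wdiv R X) :=
  forall x, exists h, local_equation D x h.

Definition q_cartier (X : int_scheme K) (D : wdiv R X) :=
  exists2 m, (0 < m)%N & cartier (wscale m D).

(* The locus, over [V], where the section [s] of [O(D)] generates [O(D)]. *)
Definition nonvanishing (Y X : int_scheme K) (pi : Y -> X) (V : set X)
  (D : wdiv R Y) (s : K) : set Y :=
  [set y | V (pi y) /\ div_stalk D y = [set s * a | a in stalk y]].

(* For [D] Cartier: over every affine open of [X], the invertible sheaf [O(D)]
   is ample. *)
Definition cartier_ample (Y X : int_scheme K) (pi : Y -> X) (D : wdiv R Y) :=
  forall V : set X, affine_open V -> forall y, V (pi y) ->
  exists (n : nat) (s : K),
    [/\ (0 < n)%N, div_sections (wscale n D) (pi @^-1` V) s,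
        nonvanishing pi V (wscale n D) s y
      & affine_open (nonvanishing pi V (wscale n D) s)].

Definition q_cartier_ample (Y X : int_scheme K) (pi : Y -> X) (D : wdiv R Y) :=
  exists m, [/\ (0 < m)%N, cartier (wscale m D)
                & cartier_ample pi (wscale m D)].

Definition exc_div (W : int_scheme K) (M : model W) : wdiv R M :=
  fun E => (`[< exceptional E >])%:R.

End Divisors.

Arguments exc_div {K} R {W} M.

(** * Canonical divisors *)

Section Canonical.
Variables (R : realType) (K : fieldType) (iota : {rmorphism R[i] -> K}).

Definition derivation (d : K -> K) :=
  [/\ forall f g, d (f + g) = d f + d g,
      forall f g, d (f * g) = d f * g + f * d g
    & forall c, d (iota c) = 0].

(* The nonzero rational top form [f dx_1 /\ ... /\ dx_n], where [f != 0] and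
   [dx_1, ..., dx_n] is a basis of the Kaehler differentials of [K/C]:
   equivalently, the dual system [d/dx_j] exists and is a basis of the
   [C]-derivations of [K].  For fixed [x], every nonzero rational top form is
   obtained in this way for a unique [f]. *)
Record top_form := TopForm {
  fdim : nat;
  fcoord : 'I_fdim -> K;
  fpartial : 'I_fdim -> K -> K;
  fcoef : K;
  fpartial_derivation : forall j, derivation (fpartial j);
  fpartial_coord : forall i j, fpartial j (fcoord i) = (i == j)%:R;
  fpartial_basis : forall d, derivation d ->
    forall g, d g = \sum_(j < fdim) d (fcoord j) * fpartial j g;
  fcoef_neq0 : fcoef != 0
}.

(* [da_1 /\ ... /\ da_n = det (da_i/dx_j) dx_1 /\ ... /\ dx_n]. *)
Definition jacobian (w : top_form) (a : 'I_(fdim w) -> K) : K :=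
  \det (\matrix_(i, j) fpartial j (a i)).

(* The elements [c] of [K] such that [c dx_1 /\ ... /\ dx_n] comes from the
   top exterior power of the Kaehler differentials of [O/C]. *)
Definition regular_coefs (w : top_form) (O : set K) : set K :=
  span O [set jacobian a | a in [set a : 'I_(fdim w) -> K | forall i, O (a i)]].

(* When [O] is the local ring of a prime divisor, the top differentials of [O]
   form a free [O]-module of rank one; if it is generated by
   [c dx_1 /\ ... /\ dx_n], then the order of [f dx_1 /\ ... /\ dx_n] is that
   of [f / c]. *)
Definition ord_form (w : top_form) (O : set K) : int :=
  ord O (fcoef w /
         xget 0 [set c | regular_coefs w O = [set u * c | u in O]]).

Definition canonical_div (w : top_form) (X : int_scheme K) : wdiv R X :=
  fun E => (ord_form w (stalk (E : X)))%:~R.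

(* Localizations of finitely generated [C]-algebras. *)
Definition eft_ring (A : set K) :=
  exists (s : seq K) (S : set K),
    let B := adjoin (range iota) [set` s] in
    [/\ S `<=` B, S 1, ~ S 0, forall f g, S f -> S g -> S (f * g)
      & A = fractions B S].

Definition ess_finite_type (X : int_scheme K) :=
  exists (n : nat) (U : 'I_n -> set X),
    (forall i, affine_open (U i) /\ eft_ring (sections (U i))) /\
    forall x, exists i, U i x.

(* The pair [(Y, D)] has log canonical singularities: the discrepancy of every
   prime divisor [F] on every normal [Z] with a (not necessarily proper)
   birational morphism [phi : Z -> Y] is at least [-1].  If [h] is a local
   equation of [m (K_Y + D)] at the center of [F], the coefficient of [F] in
   the pull-back of [K_Y + D] is [ord_F(h) / m]. *)
Definition log_canonical (w : top_form) (Y : int_scheme K) (D : wdiv R Y) :=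
  let KD := wadd (canonical_div w (X := Y)) D in
  q_cartier KD /\
  forall (Z : int_scheme K) (phi : Z -> Y),
    normal Z -> ess_finite_type Z -> birational_morphism phi ->
  forall (F : pdiv Z) (m : nat) (h : K), (0 < m)%N ->
    local_equation (wscale m KD) (phi F) h ->
    -1 <= canonical_div w F - (ord (stalk (F : Z)) h)%:~R / m%:R.

Definition log_canonical_model (w : top_form) (W : int_scheme K) (M : model W) :=
  let KE := wadd (canonical_div w (X := M)) (exc_div R M) in
  [/\ q_cartier KE, q_cartier_ample (@mmap K W M) KE
    & log_canonical w (exc_div R M)].

(** * b-divisors *)

Section BDivisors.
Variable W : int_scheme K.

(* Two prime divisors on birational models of [W] define the same prime divisor
   over [W] (the same valuation with the same center on [W]) iff one is the
   strict transform of the other; so compatibility under push-forward says that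
   the coefficients depend only on the local ring and on the center.  The local
   finiteness of the traces holds in all the cases below and is not recorded. *)
Record bdiv := BDiv {
  trace :> forall M : model W, wdiv R M;
  trace_compat : forall (M M' : model W) (E : pdiv M) (E' : pdiv M'),
    stalk (E : M) = stalk (E' : M') -> mmap (E : M) = mmap (E' : M') ->
    @trace M E = @trace M' E'
}.

Definition bdiv_ge0 (B : bdiv) :=
  forall (M : model W) (E : pdiv M), 0 <= B M E.

Program Definition bdiv_add (B B' : bdiv) : bdiv :=
  @BDiv (fun M E => B M E + B' M E) _.
Next Obligation.
by move=> B B' M M' E E' sE cE; rewrite /= (trace_compat B sE cE) (trace_compat B' sE cE).
Qed.

Program Definition bdiv_opp (B : bdiv) : bdiv := @BDiv (fun M E => - B M E) _.
Next Obligation.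
by move=> B M M' E E' sE cE; rewrite /= (trace_compat B sE cE).
Qed.

Program Definition canonical_bdiv (w : top_form) : bdiv :=
  @BDiv (fun M => canonical_div w (X := M)) _.
Next Obligation.
by move=> w M M' E E' sE _; rewrite /canonical_div sE.
Qed.

Program Definition exc_bdiv : bdiv := @BDiv (fun M => exc_div R M) _.
Next Obligation.
by move=> M M' E E' _ cE; rewrite /exc_div /exceptional cE.
Qed.

(* The infimum is over a set of integers bounded below when [a] is a nonzero
   coherent fractional ideal sheaf, so it is a minimum. *)
Program Definition Zdiv (a : frac_sheaf W) : bdiv :=
  @BDiv (fun M E => - inf [set (ord (stalk (E : M)) g)%:~R |
                            g in [set g | a (mmap (E : M)) g /\ g != 0]]) _.
Next Obligation.
by move=> a M M' E E' /= sE cE; rewrite /= sE cE.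
Qed.

Program Definition nef_envelope (D : wdiv R W) : bdiv :=
  @BDiv (fun M E =>
    limn (fun m : nat => m%:R^-1 * Zdiv (div_stalk (wscale m D)) M E)) _.
Next Obligation.
move=> D M M' E E' sE cE; apply: (congr1 (fun u : nat -> R => limn u)).
by apply/funext => m; rewrite (trace_compat (Zdiv _) sE cE).
Qed.

Definition log_discrepancy_bdiv (w : top_form) : bdiv :=
  bdiv_add (bdiv_add (canonical_bdiv w) exc_bdiv)
           (bdiv_opp (nef_envelope (canonical_div w (X := W)))).

Definition valuative_lc (w : top_form) := bdiv_ge0 (log_discrepancy_bdiv w).

(* Equality, as subsheaves of the constant sheaf [K], of the push-forward of
   [O(m (K + E))] from each model with [O_W(m K_W)]. *)
Definition pluricanonical_pushforward (w : top_form) :=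
  forall (M : model W) (m : nat), (0 < m)%N ->
  forall U : set W, open U ->
    div_sections (wscale m (wadd (canonical_div w (X := M)) (exc_div R M)))
                 (@mmap K W M @^-1` U)
    = div_sections (wscale m (canonical_div w (X := W))) U.

End BDivisors.
End Canonical.

(* Main.v *)
Require Import Defs.
From HB Require Import structures.
From mathcomp Require Import all_boot all_order all_algebra.
From mathcomp Require Import complex zify ring lra.
From mathcomp Require Import all_classical all_reals all_analysis.

(** Superadditivity of [m |-> Z(O_W(m K_W))] and Fekete's lemma make the nef
    envelope a supremum over [m], once its finiteness is known: locally on [W] the
    canonical divisor lies between two principal divisors (by bounding Jacobians
    of generators), so a section of [O_W(m K_W)] times an [m]-th power is regular
    by algebraic Hartogs.  Hence (1) says that every section of [O_W(m K_W)] is a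
    section of [O(m (K + E))] on every model; the other inclusion of (2) always
    holds, as every prime divisor of [W] has a strict transform on every model.

    Let [Y] be the log canonical model.  If it has no exceptional divisor, a
    section of [O_W(m K_W)] is one of [O_Y(m K_Y)], so its order along a divisor
    [F] over [W] is bounded by the pull-back of [K_Y], and log canonicity, applied
    to the spectrum of the valuation ring of [F], gives (2).  If [E0] is an
    exceptional divisor, let [s] be a section of a multiple [N (K_Y + E)] whose
    affine non-vanishing locus [T] contains [E0], and let [f] have a pole along [E0]
    but along no other divisor of [T] coming from [W].  For [k] large, [s^k f] is a
    section of [O_W(k N K_W)], but it is not one of [O_Y(k N (K_Y + E))]. *)

Set Implicit Arguments.
Unset Strict Implicit.
Unset Printing Implicit Defensive.
Import Order.TTheory GRing.Theory Num.Theory.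
Import numFieldNormedType.Exports.
Local Open Scope classical_set_scope.
Local Open Scope ring_scope.

(* MathComp has other constants with these names. *)
Local Notation span := Defs.span.
Local Notation pdiv := Defs.pdiv.
Local Notation jacobian := Defs.jacobian.

(** Condition (2) tests divisors on a model [M] of [W], log canonicity tests divisors over [Y], and
    there is a priori no morphism from [M] to [Y]. Instead of a normalized graph dominating both,
    the proof exploits that [log_canonical] admits every normal [Z] essentially of finite type over
    [Y], proper or not: the valuative criterion for projective morphisms gives the local ring of the
    divisor a centre on [Y], and its two-point spectrum serves as [Z]. The same criterion, applied
    to the prime divisors of [W], produces strict transforms.

    All commutative algebra takes place among subrings of [K]. The local rings are noetherian by
    Hilbert's basis theorem, and codimension one is reached through colon ideals [(O : f)]: a
    maximal one is prime, and normality turns its localization into a discrete valuation ring. This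
    one argument yields both the valuations at points of codimension one and algebraic Hartogs. *)

Section SubringTheory.
Variable K : fieldType.
Implicit Types (A O P I J M G : set K) (f g t u x y z : K).

(** * Closure properties of subrings and submodules of a field *)

Section Closure.
Variables (A : set K) (rA : subring A).

Lemma subring1 : A 1. Proof. by case: rA. Qed.
Lemma subringB x y : A x -> A y -> A (x - y). Proof. by case: rA => _ h _; apply: h. Qed.
Lemma subringM x y : A x -> A y -> A (x * y). Proof. by case: rA => _ _; apply. Qed.
Lemma subring0 : A 0. Proof. by rewrite -(subrr 1); apply: subringB subring1 subring1. Qed.
Lemma subringN x : A x -> A (- x).
Proof. by move=> Ax; rewrite -sub0r; apply: subringB subring0 Ax. Qed.
Lemma subringD x y : A x -> A y -> A (x + y).
Proof. by move=> Ax Ay; rewrite -(opprK y); apply/subringB/subringN. Qed.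
Lemma subringX x n : A x -> A (x ^+ n).
Proof.
move=> Ax; elim: n => [|n IH]; first by rewrite expr0; apply: subring1.
by rewrite exprS; apply: subringM.
Qed.
Lemma subring_sum (T : Type) (r : seq T) (F : T -> K) :
  (forall i, A (F i)) -> A (\sum_(i <- r) F i).
Proof.
move=> AF; elim/big_ind: _ => //; [exact: subring0|exact: subringD].
Qed.
Lemma subring_prod (T : Type) (r : seq T) (F : T -> K) :
  (forall i, A (F i)) -> A (\prod_(i <- r) F i).
Proof.
move=> AF; elim/big_ind: _ => //; [exact: subring1|exact: subringM].
Qed.
Lemma subring_det n (B : 'M[K]_n) : (forall i j, A (B i j)) -> A (\det B).
Proof.
move=> AB; rewrite /determinant; apply: subring_sum => s.
apply: subringM; last by apply: subring_prod.
by apply: subringX; apply: subringN; apply: subring1.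
Qed.

Lemma subring_submodule : submodule A A.
Proof.
by split; [exact: subring0|exact: subringD|exact: subringM].
Qed.

Section Submodules.
Variables (M : set K) (mM : submodule A M).
Lemma submodD x y : M x -> M y -> M (x + y). Proof. by case: mM => _ h _; apply: h. Qed.
Lemma submodM a x : A a -> M x -> M (a * x). Proof. by case: mM => _ _; apply. Qed.
Lemma submodMr a x : A a -> M x -> M (x * a). Proof. by rewrite mulrC; apply: submodM. Qed.
Lemma submod0 : M 0. Proof. by case: mM. Qed.
End Submodules.

Lemma submodule_scale M c : submodule A M -> submodule A [set c * x | x in M].
Proof.
move=> mM; split; first by exists 0; [exact: submod0 mM|rewrite mulr0].
  by move=> _ _ [x Mx <-] [y My <-]; exists (x + y); [exact: submodD|rewrite mulrDr].
by move=> a _ Aa [x Mx <-]; exists (a * x); [exact: submodM|rewrite mulrCA].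
Qed.

End Closure.

Lemma span_submodule A G : submodule A (span A G).
Proof.
split; first by move=> M [[]].
  by move=> f g hf hg M /[dup] [[[_ h _] _]] hM; apply: h; [apply: hf|apply: hg].
by move=> a f Aa hf M /[dup] [[[_ _ h] _]] hM; apply: h => //; apply: hf.
Qed.

Lemma span_min A G M : submodule A M -> G `<=` M -> span A G `<=` M.
Proof. exact: smallest_sub. Qed.

Lemma span_gen A G : G `<=` span A G.
Proof. exact: sub_gen_smallest. Qed.

Lemma adjoin_subring A G : subring (adjoin A G).
Proof.
split; first by move=> M [[]].
  by move=> f g hf hg M /[dup] [[[_ h _] _]] hM; apply: h; [apply: hf|apply: hg].
by move=> f g hf hg M /[dup] [[[_ _ h] _]] hM; apply: h; [apply: hf|apply: hg].
Qed.

Lemma adjoin_base A G : A `<=` adjoin A G.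
Proof. by move=> x Ax; apply: sub_gen_smallest; left. Qed.

Lemma adjoin_gen A G : G `<=` adjoin A G.
Proof. by move=> x Gx; apply: sub_gen_smallest; right. Qed.

Lemma adjoin_min A G T : subring T -> A `<=` T -> G `<=` T -> adjoin A G `<=` T.
Proof. by move=> rT AT GT; apply: smallest_sub => // x [/AT|/GT]. Qed.

Lemma adjoin_rcons A (s : seq K) x :
  adjoin A [set` rcons s x] = adjoin (adjoin A [set` s]) [set x].
Proof.
apply/seteqP; split.
  apply: adjoin_min; first exact: adjoin_subring.
    by move=> y Ay; do 2![apply: adjoin_base].
  move=> y /=; rewrite mem_rcons inE => /orP[/eqP->|ys]; first exact: adjoin_gen.
  by apply: adjoin_base; apply: adjoin_gen.
apply: adjoin_min; first exact: adjoin_subring.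
  apply: adjoin_min; first exact: adjoin_subring.
    exact: adjoin_base.
  by move=> y /= ys; apply: adjoin_gen => /=; rewrite mem_rcons inE ys orbT.
by move=> y /= ->; apply: adjoin_gen => /=; rewrite mem_rcons inE eqxx.
Qed.

Lemma adjoin_nil A : subring A -> adjoin A [set` [::]] = A.
Proof.
move=> rA; apply/seteqP; split; last exact: adjoin_base.
by apply: adjoin_min => //.
Qed.

(** * Noetherian subrings *)

Definition noetherian A :=
  forall I, I `<=` A -> submodule A I -> exists s : seq K, I = span A [set` s].

Lemma chain_submodule A (c : nat -> set K) :
  (forall n, submodule A (c n)) -> (forall n, c n `<=` c n.+1) ->
  submodule A (\bigcup_n c n).
Proof.
move=> mc inc.
have mon n m : (n <= m)%N -> c n `<=` c m.
  elim: m => [|m IH]; first by rewrite leqn0 => /eqP->.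
  rewrite leq_eqVlt => /orP[/eqP->//|]; rewrite ltnS => /IH h x /h; exact: inc.
split; first by exists 0%N => //; apply: submod0 (mc 0%N).
  move=> f g [n _ nf] [m _ mg]; exists (maxn n m) => //.
  apply: (submodD (mc _)); [apply: mon nf|apply: mon mg].
    exact: leq_maxl.
  exact: leq_maxr.
by move=> a f Aa [n _ nf]; exists n => //; apply: (submodM (mc n)).
Qed.

(** The union of the chain is an ideal, and its finitely many generators already lie in one term. *)
Lemma chain_stationary A (c : nat -> set K) : noetherian A ->
  (forall n, c n `<=` A) -> (forall n, submodule A (c n)) ->
  (forall n, c n `<=` c n.+1) ->
  exists n, forall m, c m `<=` c n.
Proof.
move=> nA cA mc inc.
have mon n m : (n <= m)%N -> c n `<=` c m.
  elim: m => [|m IH]; first by rewrite leqn0 => /eqP->.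
  rewrite leq_eqVlt => /orP[/eqP->//|]; rewrite ltnS => /IH h x /h; exact: inc.
have [|s Es] := nA _ _ (chain_submodule mc inc).
  by move=> x [n _ /cA].
suff [n sn] : exists n, [set` s] `<=` c n.
  exists n => m x cx; apply: (span_min (mc n) sn).
  by rewrite -Es; exists m.
have : [set` s] `<=` \bigcup_n c n by rewrite Es; apply: span_gen.
elim: s {Es} => [|y s IH] sub; first by exists 0%N => x.
have [|n sn] := IH; first by move=> x /= xs; apply: sub; rewrite /= inE xs orbT.
have [|k _ ck] := sub y; first by rewrite /= inE eqxx.
exists (maxn n k) => x /=; rewrite inE => /orP[/eqP->|xs].
  exact: mon (leq_maxr _ _) _ ck.
exact: mon (leq_maxl _ _) _ (sn _ xs).
Qed.

Lemma noetherian_max A (F : set (set K)) : noetherian A -> F !=set0 ->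
  (forall I, F I -> I `<=` A /\ submodule A I) ->
  exists2 I, F I & forall J, F J -> I `<=` J -> J `<=` I.
Proof.
move=> nA [I0 FI0] Fid; apply: contrapT => nomax.
have step (I : {I | F I}) : exists J : {J | F J}, sval I `<=` sval J /\ ~ sval J `<=` sval I.
  case: I => I FI /=; apply: contrapT => H; apply: nomax; exists I => // J FJ IJ.
  by apply: contrapT => JI; apply: H; exists (exist _ J FJ).
(* Without a maximal element, dependent choice builds a strictly increasing chain of ideals. *)
have [next nextP] := choice step.
pose c n := iter n next (exist _ I0 FI0).
have cA n : sval (c n) `<=` A /\ submodule A (sval (c n)) by apply/Fid/(svalP (c n)).
have [n H] := chain_stationary nA (fun n => (cA n).1) (fun n => (cA n).2)
  (fun n => (nextP (c n)).1).
exact: (nextP (c n)).2 (H n.+1).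
Qed.

Lemma noetherian_field A : subring A -> (forall x, A x -> x != 0 -> A x^-1) ->
  noetherian A.
Proof.
move=> rA invA I IA mI.
have [[x [Ix x0]]|nI] := pselect (exists x, I x /\ x != 0).
  exists [:: 1]; apply/seteqP; split.
    move=> y /IA Ay; rewrite -(mulr1 y); apply: (submodM (span_submodule _ _)) => //.
    by apply: span_gen; rewrite /= inE.
  apply: span_min => // y /=; rewrite inE => /eqP->.
  by rewrite -(mulVf x0); apply: (submodM mI) => //; apply: invA => //; apply: IA.
exists [::]; apply/seteqP; split.
  move=> y Iy; have [->|y0] := eqVneq y 0; first exact: submod0 (span_submodule _ _).
  by case: nI; exists y.
exact: span_min.
Qed.

End SubringTheory.

(** * Hilbert's basis theorem for subrings of a field *)

Section Hilbert.
Variable K : fieldType.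
Implicit Types (A O P I J M G : set K) (f g t u x y z : K) (p q : {poly K}).

Definition coefs_in A : set {poly K} := [set p | forall i, A p`_i].

Lemma adjoin1E A x : subring A ->
  adjoin A [set x] = [set p.[x] | p in coefs_in A].
Proof.
move=> rA; apply/seteqP; split; last first.
  move=> _ [p pA <-]; rewrite horner_coef.
  have rT := adjoin_subring A [set x].
  apply: (subring_sum rT) => i; apply: (subringM rT); first exact: adjoin_base.
  by apply: (subringX rT); apply: adjoin_gen.
apply: adjoin_min.
- split.
  + exists 1; last by rewrite hornerC.
    move=> i; rewrite coef1; case: eqP => _; [exact: subring1|exact: subring0].
  + move=> _ _ [p pA <-] [q qA <-]; exists (p - q); last by rewrite !hornerE.
    by move=> i; rewrite coefB; apply: subringB.
  + move=> _ _ [p pA <-] [q qA <-]; exists (p * q); last by rewrite !hornerE.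
    by move=> i; rewrite coefM; apply: subring_sum => // j; apply: subringM.
- move=> a Aa; exists a%:P; last by rewrite hornerC.
  by move=> i; rewrite coefC; case: eqP => // _; exact: subring0.
- move=> _ ->; exists 'X; last by rewrite hornerX.
  move=> i; rewrite coefX; case: eqP => _; [exact: subring1|exact: subring0].
Qed.

Section Step.
Variables (A : set K) (x : K) (rA : subring A) (nA : noetherian A).
Variables (I : set K).
Let T := adjoin A [set x].
Hypotheses (IT : I `<=` T) (mI : submodule T I).

(** Since [x] may be algebraic over [A], elements of [T] have no degree; degrees are taken on
    polynomials that evaluate into [I]. In [L n] the size is bounded but not prescribed, so that [0]
    belongs to it and [L n] is an ideal. *)
Let lift p := coefs_in A p /\ I p.[x].
Let L n : set K := [set c | exists p, [/\ lift p, (size p <= n.+1)%N & p`_n = c]].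

Let rT : subring T. Proof. exact: adjoin_subring. Qed.
Let AT : A `<=` T. Proof. exact: adjoin_base. Qed.
Let Tx : T x. Proof. exact: adjoin_gen. Qed.

Let lift0 : lift 0.
Proof.
split; first by move=> i; rewrite coef0; exact: subring0.
by rewrite horner0; exact: submod0 mI.
Qed.

Let liftD p q : lift p -> lift q -> lift (p + q).
Proof.
move=> [pA pI] [qA qI]; split; first by move=> i; rewrite coefD; apply: subringD.
by rewrite hornerD; apply: (submodD mI).
Qed.

Let liftZ a p : A a -> lift p -> lift (a *: p).
Proof.
move=> Aa [pA pI]; split; first by move=> i; rewrite coefZ; apply: subringM.
by rewrite hornerZ; apply: (submodM mI) => //; apply: AT.
Qed.

Let liftB p q : lift p -> lift q -> lift (p - q).
Proof.
move=> lp lq; apply: liftD => //; rewrite -scaleN1r; apply: liftZ => //.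
exact: (subringN rA (subring1 rA)).
Qed.

Let liftX p n : lift p -> lift (p * 'X^n).
Proof.
move=> [pA pI]; split.
  by move=> i; rewrite coefMXn; case: ifP => // _; exact: subring0.
rewrite hornerM hornerXn mulrC; apply: (submodM mI) => //; exact: (subringX rT _ Tx).
Qed.

Let size_mulXn p n k : (size p <= n)%N -> (size (p * 'X^k)%R <= n + k)%N.
Proof.
move=> sp; apply/leq_sizeP => j hj; have kj := leq_trans (leq_addl n k) hj.
rewrite coefMXn ltnNge kj /= nth_default // (leq_trans sp) //.
by rewrite leq_subRL // addnC.
Qed.

Let L_sub n : L n `<=` A.
Proof. by move=> _ [p [[pA _] _ <-]]. Qed.

Let L_mod n : submodule A (L n).
Proof.
split; first by exists 0; rewrite size_poly0 coef0.
  move=> _ _ [p [lp sp <-]] [q [lq sq <-]]; exists (p + q); split.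
  - exact: liftD.
  - by rewrite (leq_trans (size_polyD _ _)) // geq_max sp.
  - by rewrite coefD.
move=> a _ Aa [p [lp sp <-]]; exists (a *: p); split.
- exact: liftZ.
- by rewrite (leq_trans (size_scale_leq _ _)).
- by rewrite coefZ.
Qed.

Let L_inc n : L n `<=` L n.+1.
Proof.
move=> _ [p [lp sp <-]]; exists (p * 'X^1); split; first exact: liftX.
  by have := size_mulXn 1 sp; rewrite addn1.
by rewrite coefMXn /= subn1.
Qed.

Let reduce G n p q : lift p -> lift q ->
  (size p <= n.+1)%N -> (size q <= n.+1)%N -> q`_n = p`_n -> span T G q.[x] ->
  (forall r, lift r -> (size r <= n)%N -> span T G r.[x]) -> span T G p.[x].
Proof.
move=> lp lq sp sq e Gq H; rewrite -(subrK q p) hornerD.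
apply: (submodD (span_submodule _ _)) => //; apply: H; first exact: liftB.
apply/leq_sizeP => j; rewrite leq_eqVlt coefB => /orP[/eqP<-|hj].
  by rewrite e subrr.
by rewrite !nth_default ?subrr // (leq_trans _ hj).
Qed.

(** Generators of the ideal [L n] lift to polynomials of size at most [n + 1]; subtracting a
    combination of them lowers the degree. *)
Let low_degree n : exists s : seq K, [set` s] `<=` I /\
  forall p, lift p -> (size p <= n)%N -> span T [set` s] p.[x].
Proof.
elim: n => [|n [s [sI sP]]].
  exists [::]; split => // p _; rewrite size_poly_leq0 => /eqP->.
  by rewrite horner0; exact: submod0 (span_submodule _ _).
have [r Lr] := nA (@L_sub n) (L_mod n).
have [s' [s'I s'P]] : exists s' : seq K, [set` s'] `<=` I /\ forall c, c \in r ->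
    exists p, [/\ lift p, (size p <= n.+1)%N, p`_n = c & p.[x] \in s'].
  have : [set` r] `<=` L n by rewrite Lr; exact: span_gen.
  elim: r {Lr} => [|c r IH] rL; first by exists [::]; split.
  have [|s' [s'I s'P]] := IH; first by move=> y yr; apply: rL; rewrite /= inE yr orbT.
  have [|p [lp sp pc]] := rL c; first by rewrite /= inE eqxx.
  exists (p.[x] :: s'); split.
    by move=> y /=; rewrite inE => /orP[/eqP->|/s'I//]; case: lp.
  move=> d; rewrite inE => /orP[/eqP->|/s'P [q [lq sq qd qs]]].
    by exists p; rewrite inE eqxx.
  by exists q; rewrite inE qs orbT.
pose G := [set` s ++ s'].
have spG : forall y, span T [set` s] y -> span T G y.
  apply: span_min; first exact: span_submodule.
  by move=> y /= ys; apply: span_gen; rewrite /G /= mem_cat ys.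
exists (s ++ s'); split.
  by move=> y /=; rewrite mem_cat => /orP[/sI|/s'I].
move=> p lp sp.
have [q [lq sq qn Gq]] : exists q, [/\ lift q, (size q <= n.+1)%N, q`_n = p`_n & span T G q.[x]].
  have : L n p`_n by exists p.
  rewrite Lr; move: (p`_n); apply: span_min.
    split.
    - exists 0; rewrite size_poly0 coef0 horner0; split => //.
      exact: submod0 (span_submodule _ _).
    - move=> _ _ [q [lq sq <- Gq]] [q' [lq' sq' <- Gq']]; exists (q + q'); split.
      + exact: liftD.
      + by rewrite (leq_trans (size_polyD _ _)) // geq_max sq.
      + by rewrite coefD.
      + by rewrite hornerD; apply: (submodD (span_submodule _ _)).
    - move=> a _ Aa [q [lq sq <- Gq]]; exists (a *: q); split.
      + exact: liftZ.
      + by rewrite (leq_trans (size_scale_leq _ _)).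
      + by rewrite coefZ.
      + by rewrite hornerZ; apply: (submodM (span_submodule _ _)) => //; apply: AT.
  move=> c /= /s'P [q [lq sq qc qs]]; exists q; split=> //.
  by apply: span_gen; rewrite /G /= mem_cat qs orbT.
apply: (reduce lp lq sp sq qn Gq) => r' lr' sr'; apply: spG; exact: sP.
Qed.

Lemma hilbert_basis_ideal : exists s : seq K, I = span T [set` s].
Proof.
have [N LN] := chain_stationary nA L_sub L_mod L_inc.
have [s [sI sP]] := low_degree N.+1.
(* Beyond degree [N] the leading coefficient already occurs in [L N]. A power of ['X] raises the
   polynomial found there to degree [n]; after evaluation this power is a factor in [T]. *)
have all_deg n : forall p, lift p -> (size p <= n)%N -> span T [set` s] p.[x].
  elim: n => [|n IH] p lp sp; first by apply: sP => //; exact: leq_trans sp _.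
  have [nN|Nn] := leqP n N; first by apply: sP => //; exact: leq_trans sp _.
  have [|q [lq sq qN]] := LN n p`_n; first by exists p.
  have Nn' := ltnW Nn.
  apply: (reduce lp (liftX (n - N) lq) sp _ _ _ IH).
  - by have := size_mulXn (n - N) sq; rewrite addSn subnKC.
  - by rewrite coefMXn ltnNge leq_subr /= subKn.
  - rewrite hornerM hornerXn mulrC; apply: (submodM (span_submodule _ _)); first exact: (subringX rT _ Tx).
    exact: sP.
exists s; apply/seteqP; split; last exact: span_min.
move=> y Iy; have [p pA py] : [set p.[x] | p in coefs_in A] y.
  by rewrite -adjoin1E //; exact: IT.
by rewrite -py; apply: (all_deg (size p)) => //; split; rewrite ?py.
Qed.
End Step.

Lemma hilbert_basis A x : subring A -> noetherian A -> noetherian (adjoin A [set x]).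
Proof. by move=> rA nA I IT mI; exact: hilbert_basis_ideal. Qed.

Lemma noetherian_adjoin A (s : seq K) : subring A -> noetherian A ->
  noetherian (adjoin A [set` s]).
Proof.
move=> rA nA; elim/last_ind: s => [|s x IH]; first by rewrite adjoin_nil.
by rewrite adjoin_rcons; apply: hilbert_basis => //; exact: adjoin_subring.
Qed.

(** An ideal of [O] is generated by its trace on [A], because the denominators are units of [O]. *)
Lemma noetherian_fractions A O : subring A -> subring O -> A `<=` O ->
  (forall f, O f -> exists a s, [/\ A a, A s, unit_of O s & f = a / s]) ->
  noetherian A -> noetherian O.
Proof.
move=> rA rO AO frac nA I IO mI.
have [||s Es] := nA (I `&` A); first by move=> x [].
  split; first by split; [exact: submod0 mI|exact: subring0].
    by move=> f g [fI fA] [gI gA]; split; [exact: (submodD mI)|exact: subringD].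
  move=> a f Aa [fI fA]; split; last exact: subringM.
  by apply: (submodM mI) => //; exact: AO.
exists s; apply/seteqP; split.
  move=> f If; have [a [b [Aa Ab [b0 _ Obi] e]]] := frac _ (IO _ If).
  have : span A [set` s] a.
    rewrite -Es; split => //; have -> : a = b * f by rewrite e mulrC divfK.
    by apply: (submodM mI) => //; exact: AO.
  rewrite e mulrC => sa; apply: (submodM (span_submodule _ _)) => //.
  move: a sa {e Aa}; apply: span_min; last exact: span_gen.
  split; first exact: submod0 (span_submodule _ _).
    by move=> f' g; apply: (submodD (span_submodule _ _)).
  by move=> c f' Ac; apply: (submodM (span_submodule _ _)); exact: AO.
by apply: span_min => // y ys; have : span A [set` s] y by [exact: span_gen]; rewrite -Es => -[].
Qed.

End Hilbert.

(** * Localization at a prime and local rings *)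

Section Localization.
Variable K : fieldType.
Implicit Types (f g a b s t u x y z : K).

Section Prime.
Variables (A P : set K) (rA : subring A) (pP : prime_ideal A P).

Lemma prime_submodule : submodule A P. Proof. by case: pP. Qed.
Lemma prime_sub : P `<=` A. Proof. by case: pP. Qed.
Lemma prime_not1 : ~ P 1. Proof. by case: pP. Qed.
Lemma primeM f g : A f -> A g -> P (f * g) -> P f \/ P g.
Proof. by case: pP => _ _ _; apply. Qed.
Lemma prime_notM f g : A f -> A g -> ~ P f -> ~ P g -> ~ P (f * g).
Proof. by move=> Af Ag nf ng /(primeM Af Ag) []. Qed.
Lemma prime_neq0 f : ~ P f -> f != 0.
Proof. by move=> nf; apply/eqP => f0; apply: nf; rewrite f0; exact: submod0 prime_submodule. Qed.
Lemma primeX f n : A f -> P (f ^+ n) -> P f.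
Proof.
move=> Af; elim: n => [|n IH]; first by rewrite expr0 => /prime_not1.
by rewrite exprS => /(primeM Af (subringX rA _ Af)) [].
Qed.

Lemma localizationP f : localization A P f <->
  exists a s, [/\ A a, A s, ~ P s & f = a / s].
Proof.
split; first by move=> [a Aa [s [As nPs] <-]]; exists a, s.
by move=> [a [s [Aa As Ps ->]]]; exists a => //; exists s.
Qed.

Lemma localization_base : A `<=` localization A P.
Proof.
move=> a Aa; apply/localizationP; exists a, 1; split => //; first exact: subring1.
  exact: prime_not1.
by rewrite divr1.
Qed.

Lemma localization_subring : subring (localization A P).
Proof.
split; first exact: (localization_base (subring1 rA)).
  move=> _ _ /localizationP[a [s [Aa As Ps ->]]] /localizationP[b [t [Ab At Pt ->]]].
  apply/localizationP; exists (a * t - b * s), (s * t); split.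
  - by apply: subringB => //; apply: subringM.
  - exact: subringM.
  - exact: prime_notM.
  - by field; rewrite !prime_neq0.
move=> _ _ /localizationP[a [s [Aa As Ps ->]]] /localizationP[b [t [Ab At Pt ->]]].
apply/localizationP; exists (a * b), (s * t); split.
- exact: subringM.
- exact: subringM.
- exact: prime_notM.
- by field; rewrite !prime_neq0.
Qed.

Lemma nonunits_localizationP f : nonunits (localization A P) f <->
  exists a s, [/\ P a, A s, ~ P s & f = a / s].
Proof.
split.
  move=> [/localizationP[a [s [Aa As Ps ->]]] nu]; exists a, s; split => //.
  apply: contrapT => Pa; apply: nu; split.
  - by rewrite mulf_neq0 ?invr_eq0 ?prime_neq0.
  - by apply/localizationP; exists a, s.
  - by apply/localizationP; exists s, a; split => //; rewrite invf_div.
move=> [a [s [Pa As Ps ->]]]; split.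
  by apply/localizationP; exists a, s; split => //; exact: prime_sub.
move=> [as0 _ /localizationP[b [t [Ab At Pt e]]]].
have a0 : a != 0 by apply: contraNneq as0 => ->; rewrite mul0r.
have s0 := prime_neq0 Ps; have t0 := prime_neq0 Pt.
have : P (s * t).
  have -> : s * t = b * a.
    by move: e; rewrite invf_div => /eqP; rewrite eqr_div // => /eqP.
  exact: (submodM prime_submodule).
by move/(primeM As At) => [].
Qed.

Lemma nonunits_localization_cap : nonunits (localization A P) `&` A = P.
Proof.
apply/seteqP; split.
  move=> f [/nonunits_localizationP[a [s [Pa As Ps e]]] Af].
  have s0 := prime_neq0 Ps.
  have : P (s * f) by rewrite e mulrC divfK.
  by move/(primeM As Af) => [].
move=> f Pf; split; last exact: prime_sub.
apply/nonunits_localizationP; exists f, 1; split => //; first exact: subring1.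
  exact: prime_not1.
by rewrite divr1.
Qed.

Lemma nonunits_localization_submodule :
  submodule (localization A P) (nonunits (localization A P)).
Proof.
split.
- apply/nonunits_localizationP; exists 0, 1; split.
  + exact: submod0 prime_submodule.
  + exact: subring1.
  + exact: prime_not1.
  + by rewrite mul0r.
- move=> _ _ /nonunits_localizationP[a [s [Pa As Ps ->]]] /nonunits_localizationP[b [t [Pb At Pt ->]]].
  apply/nonunits_localizationP; exists (t * a + s * b), (s * t); split.
  + by apply: (submodD prime_submodule); apply: (submodM prime_submodule).
  + exact: subringM.
  + exact: prime_notM.
  + by field; rewrite !prime_neq0.
- move=> _ _ /localizationP[a [s [Aa As Ps ->]]] /nonunits_localizationP[b [t [Pb At Pt ->]]].
  apply/nonunits_localizationP; exists (a * b), (s * t); split.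
  + exact: (submodM prime_submodule).
  + exact: subringM.
  + exact: prime_notM.
  + by field; rewrite !prime_neq0.
Qed.

End Prime.

Section Local.
Variables (O : set K) (rO : subring O).

Lemma unit_nonunits f : O f -> unit_of O f \/ nonunits O f.
Proof. by move=> Of; have [?|?] := pselect (unit_of O f); [left|right]. Qed.

Lemma unit1 : unit_of O 1.
Proof. by split; rewrite ?oner_neq0 ?invr1 //; exact: subring1. Qed.

Lemma unitM f g : unit_of O f -> unit_of O g -> unit_of O (f * g).
Proof.
move=> [f0 Of Of'] [g0 Og Og']; split; first by rewrite mulf_neq0.
  exact: subringM.
by rewrite invfM; exact: subringM.
Qed.

Lemma unitV f : unit_of O f -> unit_of O f^-1.
Proof. by move=> [f0 Of Of']; split; rewrite ?invr_eq0 ?invrK. Qed.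

Lemma unitXz f (k : int) : unit_of O f -> unit_of O (f ^ k).
Proof.
move=> uf; have H n : unit_of O (f ^+ n).
  by elim: n => [|n IH]; [rewrite expr0; exact: unit1|rewrite exprS; exact: unitM].
by case: k => n; [exact: H|rewrite NegzE -exprnN; exact/unitV/H].
Qed.

Lemma unit_factor f g : O f -> O g -> unit_of O (f * g) -> unit_of O f.
Proof.
move=> Of Og [fg0 _ fgi]; move: (fg0); rewrite mulf_eq0 => /norP[f0 g0].
split=> //; have -> : f^-1 = g * (f * g)^-1 by field; rewrite f0 g0.
exact: subringM.
Qed.

Lemma nonunits_prime : submodule O (nonunits O) -> prime_ideal O (nonunits O).
Proof.
move=> mO; split => //; first by move=> f [].
  by move=> [_]; apply; exact: unit1.
move=> f g Of Og [_ nfg].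
have [uf|] := unit_nonunits Of; last by left.
have [ug|] := unit_nonunits Og; last by right.
by case: nfg; exact: unitM.
Qed.

Lemma prime_sub_nonunits (P : set K) : prime_ideal O P -> P `<=` nonunits O.
Proof.
move=> pP f Pf; split; first exact: (prime_sub pP).
move=> [f0 _ fi]; apply: (prime_not1 pP); rewrite -(mulVf f0).
exact: (submodM (prime_submodule pP)).
Qed.

End Local.

(** * Discrete valuation rings *)

Definition dvr (O : set K) := subring O /\ exists t, [/\ uniformizer O t, t != 0
  & forall f, f != 0 -> exists u (k : int), unit_of O u /\ f = u * t ^ k].

Section DVR.
Variables (O : set K) (dO : dvr O).

Lemma dvr_subring : subring O. Proof. by case: dO. Qed.
Let rO := dvr_subring.

(** [ord] selects an integer over all uniformizers at once. Two of them generate the same ideal,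
    hence differ by a unit, so the integer is unique and can be computed with one fixed [t]. *)
Lemma ord_spec : exists t, [/\ uniformizer O t, t != 0,
  forall u (k : int), unit_of O u -> ord O (u * t ^ k) = k
  & forall f, f != 0 -> exists2 u, unit_of O u & f = u * t ^ ord O f].
Proof.
have [_ [t [ut t0 tP]]] := dO.
have [Ot et] := ut.
have nut : ~ unit_of O t.
  have : nonunits O t by rewrite et; exists 1; [exact: subring1|rewrite mulr1].
  by case.
have uniq u (k : int) : unit_of O (u * t ^ k) -> unit_of O u -> k = 0.
  move=> uk uu; have {uk} : unit_of O (t ^ k).
    have [u0 _ _] := uu.
    by rewrite -(mulKf u0 (t ^ k)); apply: unitM => //; exact: unitV.
  have pos n : ~ unit_of O (t ^+ n.+1).
    by rewrite exprS => /(unit_factor rO Ot (subringX rO _ Ot)).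
  case: k => [[|n]|n] //; first by move=> /pos.
  by rewrite NegzE -exprnN => /unitV; rewrite invrK => /pos.
have ordE u (k : int) : unit_of O u -> ord O (u * t ^ k) = k.
  move=> uu; apply: xget_unique.
    by exists t, u.
  move=> l [s [v [[Os es] uv e]]].
  have [a Oa sE] : [set t * a | a in O] s.
    by rewrite -et es; exists 1; [exact: subring1|rewrite mulr1].
  have [b Ob tE] : [set s * a | a in O] t.
    by rewrite -es et; exists 1; [exact: subring1|rewrite mulr1].
  have ab : a * b = 1.
    apply: (mulfI t0); rewrite mulr1 mulrA sE; exact: tE.
  have ua : unit_of O a.
    by apply: (unit_factor rO Oa Ob); rewrite ab; exact: unit1.
  apply/eqP; rewrite -subr_eq0; apply/eqP.
  apply: (uniq (v * a ^ l)); last by apply: unitM => //; exact: unitXz.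
  have -> : v * a ^ l * t ^ (l - k) = u.
    rewrite expfzDr // mulrA.
    have -> : v * a ^ l * t ^ l = u * t ^ k by rewrite e -sE expfzMl; ring.
    by rewrite -invr_expz mulfK // expfz_neq0.
  exact: uu.
exists t; split => // f f0; have [u [k [uu ->]]] := tP f f0.
by exists u => //; rewrite ordE.
Qed.

Lemma ordM f g : f != 0 -> g != 0 -> ord O (f * g) = ord O f + ord O g.
Proof.
have [t [_ t0 oE oP]] := ord_spec.
move=> /oP[u uu fE] /oP[v uv gE].
have -> : f * g = (u * v) * t ^ (ord O f + ord O g).
  by rewrite expfzDr // {1}fE {1}gE; ring.
by rewrite oE //; exact: unitM.
Qed.

Lemma ord1 : ord O 1 = 0.
Proof.
have [t [_ t0 oE _]] := ord_spec.
by rewrite -[X in ord O X](mulr1 1) -[X in ord O (1 * X)](expr0z t) oE //; exact: unit1.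
Qed.

Lemma ordX f n : f != 0 -> ord O (f ^+ n) = n%:Z * ord O f.
Proof.
move=> f0; elim: n => [|n IH]; first by rewrite expr0 mul0r; exact: ord1.
by rewrite exprS ordM ?expf_neq0 // IH -addn1 PoszD mulrDl mul1r addrC.
Qed.

Lemma ordV f : f != 0 -> ord O f^-1 = - ord O f.
Proof.
move=> f0; apply/eqP; rewrite -addr_eq0 addrC -ordM ?invr_eq0 //.
by rewrite mulfV //; apply/eqP; exact: ord1.
Qed.

Lemma ord_gt0 f : f != 0 -> nonunits O f <-> 0 < ord O f.
Proof.
have [t [[Ot et] t0 oE oP]] := ord_spec.
move=> /oP[u uu]; have [u0 Ou _] := uu; move: (ord O f) => [[|n]|n] ->.
- by rewrite expr0z mulr1; split => // -[].
- split => // _; rewrite et; exists (u * t ^+ n); last by rewrite -exprnP exprS; ring.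
  by apply: subringM => //; exact: subringX.
- split => // -[Of _]; have : nonunits O u.
    rewrite et; exists (t ^+ n * (u * t ^ Negz n)).
      by apply: subringM => //; exact: subringX.
    by rewrite NegzE -exprnN mulrA -exprS mulrCA mulfV ?mulr1 // expf_neq0.
  by case.
Qed.

Lemma ord_ge0 f : f != 0 -> O f <-> 0 <= ord O f.
Proof.
move=> f0; split.
  move=> Of; rewrite leNgt; apply/negP => h.
  have : nonunits O f^-1 by apply/ord_gt0; rewrite ?invr_eq0 // ordV // oppr_gt0.
  by case=> Ofi; apply; apply: unitV; split.
rewrite le_eqVlt => /orP[/eqP e|/(ord_gt0 f0)[]//].
have [t [_ t0 oE oP]] := ord_spec.
by have [u [_ Ou _]] := oP f f0; rewrite -e expr0z mulr1 => ->.
Qed.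

Lemma dvr_total f : O f \/ O f^-1.
Proof.
have [->|f0] := eqVneq f 0; first by left; exact: subring0.
have [h|h] := leP 0 (ord O f); first by left; apply/ord_ge0.
by right; apply/ord_ge0; rewrite ?invr_eq0 // ordV // oppr_ge0 ltW.
Qed.

Lemma dvr_nonunits_submodule : submodule O (nonunits O).
Proof.
have add a b : nonunits O a -> nonunits O b -> b != 0 -> O (a / b) ->
    nonunits O (a + b).
  move=> [Oa _] [Ob nb] b0 Oab; split; first exact: subringD.
  have -> : a + b = b * (1 + a / b) by field.
  move=> /(unit_factor rO Ob) h; apply: nb; apply: h.
  by apply: subringD => //; exact: subring1.
split.
- split; first exact: subring0.
  by move=> []; rewrite eqxx.
- move=> a b ma mb; have [->|a0] := eqVneq a 0; first by rewrite add0r.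
  have [->|b0] := eqVneq b 0; first by rewrite addr0.
  have [ab|] := dvr_total (a / b); first exact: add.
  by rewrite invf_div addrC; exact: add.
- move=> a b Oa [Ob nb]; split; first exact: subringM.
  by rewrite mulrC => /(unit_factor rO Ob Oa).
Qed.

(** A new element [f] would have its inverse in the maximal ideal of [O], hence in that of [O'],
    where [f] makes it a unit. *)
Lemma dvr_maximal (O' : set K) : O `<=` O' -> nonunits O `<=` nonunits O' ->
  O' `<=` O.
Proof.
move=> OO' mm' f O'f; have [->|f0] := eqVneq f 0; first exact: subring0.
apply/ord_ge0 => //; rewrite leNgt; apply/negP => h.
have [|O'fi] := mm' f^-1.
  by apply/ord_gt0; rewrite ?invr_eq0 // ordV // oppr_gt0.
by apply; split; rewrite ?invr_eq0 ?invrK.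
Qed.

Lemma dvr_dim1 : dim1 O.
Proof.
have [t [[Ot et] t0 oE oP]] := ord_spec.
have nt : nonunits O t by rewrite et; exists 1; [exact: subring1|rewrite mulr1].
split; first by move=> e; move: nt; rewrite e /= => /eqP; apply/negP.
move=> P pP; have [[q [Pq q0]]|nP] := pselect (exists q, P q /\ q != 0).
  right; apply/seteqP; split; first exact: prime_sub_nonunits.
  have [u uu qE] := oP q q0; have [u0 Ou Oui] := uu.
  have : 0 <= ord O q by apply/ord_ge0 => //; exact: (prime_sub pP).
  case: (ord O q) qE => // n qE _.
  have Pt : P t.
    apply: (primeX rO pP (n := n) Ot).
    have -> : t ^+ n = u^-1 * q by rewrite qE mulKf.
    exact: (submodM (prime_submodule pP)).
  by rewrite et => _ [a Oa <-]; exact: (submodMr (prime_submodule pP)).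
left; apply/seteqP; split.
  by move=> q Pq /=; apply/eqP; apply: contrapT => /negP q0; apply: nP; exists q.
by move=> _ ->; exact: submod0 (prime_submodule pP).
Qed.

End DVR.

Definition local_domain (O : set K) := [/\ subring O, submodule O (nonunits O),
  noetherian O & forall f, exists a b, [/\ O a, O b, b != 0 & f = a / b]].

Lemma uniformizer_dvr (O : set K) t : local_domain O -> t != 0 -> uniformizer O t ->
  dvr O.
Proof.
move=> [rO _ nO frac] t0 ut; have [Ot et] := ut.
have nt : nonunits O t by rewrite et; exists 1; [exact: subring1|rewrite mulr1].
split=> //; exists t; split => // f f0.
have pos g : O g -> g != 0 -> exists u (k : int), unit_of O u /\ g = u * t ^ k.
  move=> Og g0.
  (* A factor [t] splits off only finitely often: the ideals generated by [g / t ^+ n] increase,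
     strictly so because [t] is not a unit. *)
  pose F : set (set K) := [set I | exists n, O (g / t ^+ n) /\ I = [set g / t ^+ n * x | x in O]].
  have [||_ [n [On ->]] nmax] := noetherian_max (F := F) nO.
  - by exists [set g / t ^+ 0 * x | x in O], 0%N; rewrite expr0 divr1.
  - move=> _ [n [On ->]]; split; first by move=> _ [x Ox <-]; exact: subringM.
    exact/submodule_scale/subring_submodule.
  have tn0 : t ^+ n != 0 by rewrite expf_neq0.
  exists (g / t ^+ n), n; split; last by rewrite -exprnP divfK.
  have [//|] := unit_nonunits On; rewrite et => -[a Oa ae].
  have aE : a = g / t ^+ n.+1.
    by apply: (mulfI t0); rewrite ae exprS; field; rewrite t0 tn0.
  have a0 : a != 0 by rewrite aE mulf_neq0 // invr_eq0 expf_neq0.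
  have : [set g / t ^+ n * x | x in O] a.
    apply: (nmax [set g / t ^+ n.+1 * x | x in O]).
    - by exists n.+1; rewrite -aE.
    - by move=> _ [x Ox <-]; exists (t * x); [exact: subringM|rewrite -ae -aE; ring].
    - by exists 1; [exact: subring1|rewrite mulr1 aE].
  move=> [c Oc].
  rewrite -ae -mulrA mulrCA => /eqP; rewrite -subr_eq0 -[X in _ - X]mulr1 -mulrBr.
  rewrite mulf_eq0 (negbTE a0) subr_eq0 /= => /eqP tc.
  have [_ []] := nt; apply: (unit_factor rO Ot Oc); rewrite tc; exact: unit1.
have [a [b [Oa Ob b0 fE]]] := frac f.
have a0 : a != 0 by apply: contraNneq f0 => a0; rewrite fE a0 mul0r.
have [u [k [uu ae]]] := pos a Oa a0; have [v [l [uv be]]] := pos b Ob b0.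
exists (u / v), (k - l); split; first by apply: unitM => //; exact: unitV.
by rewrite fE ae be expfzDr // invfM -invr_expz; ring.
Qed.

(* The chain of ideals [v A[z]_{<= n}] plays the role of the determinant trick. *)
Lemma integral_of_bounded_powers (A : set K) v z : subring A -> noetherian A ->
  v != 0 -> (forall k, A (v * z ^+ k)) ->
  exists p, [/\ p \is monic, forall i, A p`_i & root p z].
Proof.
move=> rA nA v0 vz.
pose c n : set K := [set v * p.[z] | p in [set p | coefs_in A p /\ (size p <= n)%N]].
have [|||n cn] := chain_stationary (c := c) nA.
- move=> n _ [p [pA sp] <-]; rewrite horner_coef mulr_sumr.
  by apply: subring_sum => // i; rewrite mulrCA; apply: subringM.
- move=> n; split.
  + by exists 0; [split; [move=> i; rewrite coef0; exact: subring0|rewrite size_poly0]|rewrite horner0 mulr0].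
  + move=> _ _ [p [pA sp] <-] [q [qA sq] <-]; exists (p + q); last by rewrite hornerD mulrDr.
    split; first by move=> i; rewrite coefD; exact: subringD.
    by rewrite (leq_trans (size_polyD _ _)) // geq_max sp.
  + move=> a _ Aa [p [pA sp] <-]; exists (a *: p); last by rewrite hornerZ mulrCA.
    split; first by move=> i; rewrite coefZ; exact: subringM.
    by rewrite (leq_trans (size_scale_leq _ _)).
- by move=> n _ [p [pA sp] <-]; exists p => //; split => //; exact: leqW.
have [|p [pA sp] /(mulfI v0) pz] := cn n.+1 (v * z ^+ n).
  exists 'X^n; last by rewrite hornerXn.
  split; last by rewrite size_polyXn.
  by move=> i; rewrite coefXn; case: eqP => _; [exact: subring1|exact: subring0].
exists ('X^n - p); split.
- by rewrite monicE lead_coefDl ?lead_coefXn // size_polyN size_polyXn ltnS.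
- move=> i; rewrite coefB coefXn; apply: subringB => //.
  by case: eqP => _; [exact: subring1|exact: subring0].
- by rewrite /root hornerD hornerN hornerXn pz subrr.
Qed.

(* If [z] does not map the maximal ideal into itself, it maps it onto the ring
   and [1 / z] is a uniformizer; otherwise [z] is integral. *)
Lemma integrally_closed_uniformizer (O : set K) z : local_domain O ->
  integrally_closed O -> nonunits O <> [set 0] -> ~ O z ->
  (forall p, nonunits O p -> O (p * z)) ->
  exists2 t, t != 0 & uniformizer O t.
Proof.
move=> [rO mO nO _] cO nf nz hz.
have [v [mv v0]] : exists v, nonunits O v /\ v != 0.
  apply: contrapT => h; apply: nf; apply/seteqP; split.
    by move=> x mx /=; apply/eqP; apply: contrapT => /negP x0; apply: h; exists x.
  by move=> _ ->; exact: submod0 mO.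
have [stab|] := pselect (forall p, nonunits O p -> nonunits O (p * z)).
  have [|q [mq qO qz]] := integral_of_bounded_powers (z := z) rO nO v0.
    move=> k; suff [] : nonunits O (v * z ^+ k) by [].
    elim: k => [|k IH]; first by rewrite expr0 mulr1.
    by rewrite exprSr mulrA; exact: stab.
  by case: nz; exact: cO qz.
move=> /existsNP[p /not_implyP[mp npz]].
have [upz|//] := unit_nonunits (hz p mp).
have [pz0 _ Opzi] := upz; move: (pz0); rewrite mulf_eq0 => /norP[p0 z0].
have zi : z^-1 = (p * z)^-1 * p by field; rewrite p0 z0.
have mzi : nonunits O z^-1 by rewrite zi; exact: (submodM mO).
exists z^-1; first by rewrite invr_eq0.
split; first by case: mzi.
apply/seteqP; split.
  by move=> q mq; exists (q * z); [exact: hz|rewrite mulrC mulfK].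
by move=> _ [a Oa <-]; exact: (submodMr mO).
Qed.

Definition colon (O : set K) f : set K := [set r | O r /\ O (r * f)].

Lemma colon_submodule (O : set K) f : subring O -> submodule O (colon O f).
Proof.
move=> rO; split.
- by split; rewrite ?mul0r; exact: subring0.
- by move=> r s [Or Orf] [Os Osf]; split; rewrite ?mulrDl; exact: subringD.
- by move=> a r Oa [Or Orf]; split; rewrite -?mulrA; exact: subringM.
Qed.

(** Among the annihilators of the nonzero multiples of the class of [f] in [K / O], a maximal one is
    prime. *)
Lemma colon_prime (O : set K) f : subring O -> noetherian O -> ~ O f ->
  exists r, [/\ O r, ~ O (r * f) & prime_ideal O (colon O (r * f))].
Proof.
move=> rO nO nf.
pose F : set (set K) := [set I | exists r, [/\ O r, ~ O (r * f) & I = colon O (r * f)]].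
have [||_ [r [Or nrf ->]] rmax] := noetherian_max (F := F) nO.
- by exists (colon O (1 * f)), 1; split; rewrite ?mul1r //; exact: subring1.
- by move=> _ [r [Or _ ->]]; split; [move=> x []|exact: colon_submodule].
exists r; split => //; split; first by move=> x [].
- exact: colon_submodule.
- by move=> [_]; rewrite mul1r.
move=> a b Oa Ob [_ abrf]; have [arf|narf] := pselect (O (a * (r * f))).
  by left; split.
right; apply: (rmax (colon O ((a * r) * f))).
- by exists (a * r); split => //; [exact: subringM|rewrite -mulrA].
- move=> x [Ox xrf]; split => //.
  have -> : x * (a * r * f) = a * (x * (r * f)) by ring.
  exact: subringM.
- by split => //; have -> : b * (a * r * f) = a * b * (r * f) by ring.
Qed.

(** For a nonzero [b] in the maximal ideal, the associated prime of [b^-1] modulo [O] contains [b];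
    in dimension one it is therefore the maximal ideal, and normality yields a uniformizer. *)
Lemma dim1_dvr (O : set K) : local_domain O -> integrally_closed O -> dim1 O -> dvr O.
Proof.
move=> lO cO [nf d1]; have [rO mO nO _] := lO.
have [b [mb b0]] : exists b, nonunits O b /\ b != 0.
  apply: contrapT => h; apply: nf; apply/seteqP; split.
    by move=> x mx /=; apply/eqP; apply: contrapT => /negP x0; apply: h; exists x.
  by move=> _ ->; exact: submod0 mO.
have [Ob nb] := mb.
have [|r [Or nrb pP]] := colon_prime (f := b^-1) rO nO.
  by move=> Obi; apply: nb.
have [e|e] := d1 _ pP.
  suff : [set 0] b by move=> /eqP; rewrite (negbTE b0).
  by rewrite -e; split => //; rewrite mulrCA mulfV // mulr1.
have [|t t0 ut] := integrally_closed_uniformizer lO cO nf nrb.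
  by rewrite -e => p [].
exact: uniformizer_dvr ut.
Qed.

(* The associated prime [P] of [f] modulo [O] has depth one. *)
Lemma depth1_prime (O : set K) f : local_domain O -> ~ O f ->
  exists P z, [/\ prime_ideal O P, P <> [set 0], ~ localization O P f,
    ~ localization O P z &
    forall p, nonunits (localization O P) p -> localization O P (p * z)].
Proof.
move=> [rO mO nO frac] nf.
have [r [Or nrf pP]] := colon_prime rO nO nf.
exists (colon O (r * f)), (r * f); split => //.
- have [a [b [Oa Ob b0 fE]]] := frac f.
  move=> e; suff : [set 0] b by move=> /eqP; rewrite (negbTE b0).
  rewrite -e; split => //; have -> : b * (r * f) = r * a by rewrite fE; field; rewrite b0.
  exact: subringM.
- move=> /localizationP[a [s [Oa Os ns e]]]; apply: (ns); split => //.
  have s0 := prime_neq0 pP ns.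
  have -> : s * (r * f) = r * a by rewrite e; field; rewrite s0.
  exact: subringM.
- move=> /localizationP[a [s [Oa Os ns e]]]; apply: (ns); split => //.
  by rewrite e mulrC divfK // (prime_neq0 pP ns).
- move=> p /(nonunits_localizationP pP)[a [s [[Oa Orfa] Os ns ->]]].
  apply/localizationP; exists (a * (r * f)), s; split => //.
  by rewrite mulrAC.
Qed.

End Localization.

(** * Domination of local rings *)

Section Dominate.
Variable K : fieldType.
Implicit Types (O A P : set K) (f g : K).

Definition dominates O O' := O' `<=` O /\ nonunits O' `<=` nonunits O.

Lemma dominates_trans O1 O2 O3 : dominates O1 O2 -> dominates O2 O3 -> dominates O1 O3.
Proof. by move=> [h1 h2] [k1 k2]; split=> x; [move/k1/h1|move/k2/h2]. Qed.

Lemma unit_of_sub O O' f : O' `<=` O -> unit_of O' f -> unit_of O f.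
Proof. by move=> h [f0 Of Ofi]; split => //; exact: h. Qed.

Lemma nonunits_sub O O' f : O' `<=` O -> O' f -> nonunits O f -> nonunits O' f.
Proof. by move=> h O'f [_ nu]; split => // /(unit_of_sub h). Qed.

Lemma dominates_centre O O' A : dominates O O' -> A `<=` O' ->
  nonunits O' `&` A = nonunits O `&` A.
Proof.
move=> [h1 h2] AO; apply/seteqP; split => f [mf Af]; split => //; first exact: h2.
by apply: (nonunits_sub h1) mf; exact: AO.
Qed.

Lemma prime_contraction O A P : subring A -> A `<=` O -> prime_ideal O P ->
  prime_ideal A (P `&` A).
Proof.
move=> rA AO pP; have mP := prime_submodule pP; split.
- by move=> f [].
- split; first by split; [exact: submod0 mP|exact: subring0].
    by move=> f g [Pf Af] [Pg Ag]; split; [exact: (submodD mP)|exact: subringD].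
  by move=> a f Aa [Pf Af]; split; [apply: (submodM mP) => //; exact: AO|exact: subringM].
- by case=> /(prime_not1 pP).
- move=> f g Af Ag [Pfg _].
  by have [Pf|Pg] := primeM pP (AO _ Af) (AO _ Ag) Pfg; [left|right].
Qed.

(** The centre of [O] in a projective space lies in the chart of a coordinate of least valuation. *)
Lemma dvr_min_ratio O (s : seq K) : dvr O -> (exists2 g, g \in s & g != 0) ->
  exists g, [/\ g \in s, g != 0 & forall h, h \in s -> O (h / g)].
Proof.
move=> dO; have rO := dvr_subring dO.
elim: s => [[]//|a s IH] ex.
have [/IH[g [gs g0 gO]]|nex] := pselect (exists2 g, g \in s & g != 0).
  have [Oag|Oga] := dvr_total dO (a / g).
    exists g; split => //; first by rewrite inE gs orbT.
    by move=> h; rewrite inE => /orP[/eqP->//|/gO].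
  have [a0|a0] := eqVneq a 0.
    exists g; split => //; first by rewrite inE gs orbT.
    by move=> h; rewrite inE => /orP[/eqP->|/gO//]; rewrite a0 mul0r; exact: subring0.
  exists a; split => //; first by rewrite inE eqxx.
  move=> h; rewrite inE => /orP[/eqP->|/gO hg]; first by rewrite divff //; exact: subring1.
  have -> : h / a = (h / g) * (a / g)^-1 by field; rewrite a0 g0.
  exact: subringM.
have a0 : a != 0.
  case: ex => g; rewrite inE => /orP[/eqP->//|gs g0]; by case: nex; exists g.
exists a; split => //; first by rewrite inE eqxx.
move=> h; rewrite inE => /orP[/eqP->|hs]; first by rewrite divff //; exact: subring1.
have [->|h0] := eqVneq h 0; first by rewrite mul0r; exact: subring0.
by case: nex; exists h.
Qed.

End Dominate.

(** * Local rings of integral schemes *)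

Section Schemes.
Variable K : fieldType.
Implicit Types (f g : K) (X : int_scheme K).

Lemma sections_subring X (U : set X) : subring (sections U).
Proof.
split; first by move=> x _; exact: subring1 (stalk_subring x).
  by move=> f g hf hg x Ux; apply: (subringB (stalk_subring x)); [exact: hf|exact: hg].
by move=> f g hf hg x Ux; apply: (subringM (stalk_subring x)); [exact: hf|exact: hg].
Qed.

Lemma sections_stalk X (U : set X) (x : X) : U x -> sections U `<=` stalk x.
Proof. by move=> Ux f; apply. Qed.

Definition centre X (U : set X) (x : X) : set K := nonunits (stalk x) `&` sections U.

Section Affine.
Variables (X : int_scheme K) (U : set X) (aU : affine_open U).

Lemma affine_is_open : open U. Proof. by case: aU. Qed.

Lemma affine_frac f : exists a b, [/\ sections U a, sections U b, b != 0 & f = a / b].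
Proof.
have [_ e _ _ _] := aU; have : fractions (sections U) (sections U `\ 0) f by rewrite e.
move=> [a Aa [b [Ab b0] <-]]; exists a, b; split => //; exact/eqP.
Qed.

Lemma affine_prime (x : X) : U x -> prime_ideal (sections U) (centre U x).
Proof. by have [_ _ h _ _] := aU; move=> /h []. Qed.

Lemma affine_stalk (x : X) : U x -> stalk x = localization (sections U) (centre U x).
Proof. by have [_ _ h _ _] := aU; move=> /h []. Qed.

Lemma affine_point (P : set K) : prime_ideal (sections U) P ->
  exists2 x, U x & centre U x = P.
Proof. by have [_ _ _ h _] := aU; move=> /h [x [[Ux e] _]]; exists x. Qed.

Lemma affine_inj (x y : X) : U x -> U y -> centre U x = centre U y -> x = y.
Proof.
have [_ _ _ h _] := aU; move=> Ux Uy e.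
have [z [_ zP]] := h _ (affine_prime Ux).
by rewrite -(zP x) // -(zP y).
Qed.

Lemma affine_basic_open (I : set K) : I `<=` sections U ->
  open [set x | U x /\ ~ (I `<=` centre U x)].
Proof.
have [_ _ _ _ h] := aU; move=> IA; apply/h; first by move=> x [].
by exists I.
Qed.

Lemma affine_openP (V : set X) : open V -> V `<=` U ->
  exists2 I, I `<=` sections U & V = [set x | U x /\ ~ (I `<=` centre U x)].
Proof. by have [_ _ _ _ h] := aU; move=> oV VU; apply/h. Qed.

End Affine.

Variable X : int_scheme K.
Implicit Types (x y : X) (U V : set X).

Lemma stalk_local x : submodule (stalk x) (nonunits (stalk x)).
Proof.
have [U aU Ux] := affine_cover x; rewrite (affine_stalk aU Ux).
exact: nonunits_localization_submodule (sections_subring _) (affine_prime aU Ux).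
Qed.

Lemma stalk_frac x f : exists a b, [/\ stalk x a, stalk x b, b != 0 & f = a / b].
Proof.
have [U aU Ux] := affine_cover x; have [a [b [Aa Ab b0 e]]] := affine_frac aU f.
by exists a, b; split => //; exact: (sections_stalk Ux).
Qed.

(** Open sets are stable under generization: a set of functions not contained in the prime of [x] is
    not contained in a smaller prime. *)
Lemma open_affine_sub U x : open U -> U x -> forall y V, affine_open V -> V x -> V y ->
  centre V y `<=` centre V x -> U y.
Proof.
move=> oU Ux y V aV Vx Vy yx.
have [|I IA e] := affine_openP aV (openI oU (affine_is_open aV)); first by move=> z [].
have : (U `&` V) x by [].
rewrite e => -[_ nI]; suff [] : (U `&` V) y by [].
by rewrite e; split => // h; apply: nI => f /h /yx.
Qed.

Lemma generization x (Q : set K) : prime_ideal (stalk x) Q ->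
  exists x', stalk x' = localization (stalk x) Q /\ forall U, open U -> U x -> U x'.
Proof.
move=> pQ; have [V aV Vx] := affine_cover x.
have rA := sections_subring V; have Ax := sections_stalk Vx.
have [x' Vx' e] := affine_point aV (prime_contraction rA Ax pQ).
have pP := affine_prime aV Vx.
exists x'; split; last first.
  move=> U oU Ux; apply: (open_affine_sub oU Ux aV) => //; rewrite e => f [Qf Af].
  split => //; exact: (prime_sub_nonunits pQ).
rewrite (affine_stalk aV Vx') e; have pQA := prime_contraction rA Ax pQ.
apply/seteqP; split => f /localizationP[a [s [Aa As ns ->]]]; apply/localizationP.
  by exists a, s; split => //; [exact: Ax|exact: Ax|move=> Qs; apply: ns].
(* Elements of the stalk are themselves fractions; clearing denominators, [(b / r) / (c / t)]
   becomes [(b * t) / (r * c)]. *)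
move: Aa As ns; rewrite {1 2}(affine_stalk aV Vx).
move=> /localizationP[b [r [Ab Ar Pr ->]]] /localizationP[c [t [Ac At Pt ->]]] ns.
have r0 := prime_neq0 pP Pr; have t0 := prime_neq0 pP Pt.
have Qrc : ~ Q (r * c).
  move=> Qrc; apply: ns; have -> : c / t = (1 / (r * t)) * (r * c) by field; rewrite r0 t0.
  apply: (submodM (prime_submodule pQ)) => //; rewrite (affine_stalk aV Vx).
  apply/localizationP; exists 1, (r * t); split => //.
  - exact: subring1 rA.
  - exact: (subringM rA Ar At).
  - exact: (prime_notM pP).
have rc0 := prime_neq0 pQ Qrc.
have c0 : c != 0 by apply: contraNneq rc0 => ->; rewrite mulr0.
exists (b * t), (r * c); split; [exact: (subringM rA)|exact: (subringM rA)|by move=> []|].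
by field; rewrite r0 t0 c0.
Qed.

Lemma stalkT_in_open x U : stalk x = setT -> open U -> U !=set0 -> U x.
Proof.
move=> xT oU Un; have [V aV Vx] := affine_cover x.
have [z [Uz Vz]] := points_irreducible oU (affine_is_open aV) Un (ex_intro _ x Vx).
apply: (open_affine_sub oU Uz aV) => // f [[_ nf] Af].
have [->|f0] := eqVneq f 0; first exact: submod0 (prime_submodule (affine_prime aV Vz)).
by case: nf; split => //; rewrite xT.
Qed.

Lemma field_stalk x : nonunits (stalk x) `<=` [set 0] -> stalk x = setT.
Proof.
move=> h; apply/seteqP; split => // f _.
have [a [b [Aa Ab b0 ->]]] := stalk_frac x f.
apply: (subringM (stalk_subring x)) => //.
have [[]//|/h e] := unit_nonunits Ab.
by move: b0; rewrite e eqxx.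
Qed.

Lemma generic_point : exists x, stalk x = setT /\ forall U, open U -> U !=set0 -> U x.
Proof.
have [x _] := points_inhabited X.
have p0 : prime_ideal (stalk x) [set 0].
  split.
  - by move=> _ ->; exact: subring0 (stalk_subring x).
  - split => //; first by move=> _ _ -> ->; rewrite /= addr0.
    by move=> a _ _ ->; rewrite /= mulr0.
  - by move=> /eqP; rewrite oner_eq0.
  - by move=> f g _ _ /= /eqP; rewrite mulf_eq0 => /orP[] /eqP; [left|right].
have [x' [e _]] := generization p0.
have xT : stalk x' = setT.
  rewrite e; apply/seteqP; split => // f _; apply/localizationP.
  have [a [b [Aa Ab b0 fE]]] := stalk_frac x f.
  by exists a, b; split => //= /eqP; rewrite (negbTE b0).
by exists x'; split => // U; exact: stalkT_in_open.
Qed.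

Lemma stalk_spread x f : stalk x f ->
  exists U, [/\ open U, U x & forall y, U y -> stalk y f].
Proof.
have [V aV Vx] := affine_cover x; have pP := affine_prime aV Vx.
rewrite (affine_stalk aV Vx) => /localizationP[a [s [Aa As ns ->]]].
exists [set y | V y /\ ~ ([set s] `<=` centre V y)]; split.
- by apply: affine_basic_open => // _ ->.
- by split => // h; apply: ns; exact: h.
- move=> y [Vy hs]; apply: (subringM (stalk_subring y)).
    exact: (sections_stalk Vy).
  have [[]//|my] := unit_nonunits (sections_stalk Vy As).
  by case: hs => _ ->.
Qed.

Section Normal.
Hypotheses (nX : normal X) (lX : forall x, local_domain (stalk x)).

Lemma codim1_dvr x : codim1 x -> dvr (stalk x).
Proof. by move=> c; apply: dim1_dvr. Qed.

(** Otherwise an associated prime of [f] localizes, by normality, to a discrete valuation ring that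
    misses [f]. Its point has codimension one and, being a generization of [x], lies in [U], where
    [f] is regular at such points. *)
Lemma hartogs x U f : open U -> U x ->
  (forall F : pdiv X, U F -> stalk (F : X) f) -> stalk x f.
Proof.
move=> oU Ux H; apply: contrapT => nf.
have [P [z [pP P0 nPf nPz hz]]] := depth1_prime (lX x) nf.
have [x' [e sx']] := generization pP.
have rx := stalk_subring x.
have [|||t t0 ut] := integrally_closed_uniformizer (O := stalk x') (z := z) (lX x') (@nX x').
- move=> h; apply: P0; rewrite -(nonunits_localization_cap rx pP) -e h.
  by apply/seteqP; split => [y []//|_ -> /=]; split => //; exact: subring0.
- by rewrite e.
- by rewrite e.
have c1 : codim1 x' := dvr_dim1 (uniformizer_dvr (lX x') t0 ut).
by apply: nPf; rewrite -e; apply: (H (PDiv c1)); exact: sx'.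
Qed.

End Normal.

End Schemes.

(** * The valuative criterion for projective birational morphisms *)

Section Projective.
Variables (K : fieldType) (Y X : int_scheme K) (pi : Y -> X).
Hypotheses (bpi : birational_morphism pi) (ppi : projective pi).

Lemma birational_dominates (y : Y) : dominates (stalk y) (stalk (pi y)).
Proof. by case: bpi => _ h; have [] := h y. Qed.

Lemma preimage_open (U : set X) : open U -> open (pi @^-1` U).
Proof. by case: bpi => /continuousP h _; exact: h. Qed.

Lemma birational_generic (y : Y) : stalk y = setT -> stalk (pi y) = setT.
Proof.
move=> yT; apply: field_stalk => f /(birational_dominates y).2.
rewrite yT => -[_ nf]; apply: contrapT => f0; apply: nf; split => //; exact/eqP.
Qed.

(** The coordinate ring of the chart given by a generator of least valuation is contained in [O],
    and the maximal ideal of [O] contracts to a prime of it, the point [y]. The stalks at [pi y] and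
    [x] are both dominated by [O], so the two points define the same prime over [V]. *)
Lemma valuative_criterion (O : set K) (x : X) : dvr O -> dominates O (stalk x) ->
  exists2 y, pi y = x & dominates O (stalk y).
Proof.
move=> dO Ox; have rO := dvr_subring dO.
have [J cJ /(_ x)[V [s [[aV Vx] _ charts cover]]]] := ppi.
(* Some generators may be [0]; the chart through the generic point of [Y] supplies a nonzero one. *)
have ex0 : exists2 g, g \in s & g != 0.
  have [y [yT _]] := generic_point Y.
  have Vy : V (pi y).
    apply: stalkT_in_open (birational_generic yT) (affine_is_open aV) _; by exists x.
  by have [g [gs g0 _]] := cover y Vy; exists g.
have [g [gs g0 gO]] := dvr_min_ratio dO ex0.
have [aC eC] := charts g gs g0.
have VO : sections V `<=` O by move=> f /(sections_stalk Vx) /Ox.1.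
have AO : sections (chart pi V s g) `<=` O.
  by rewrite eC; apply: adjoin_min => // _ [h hs <-]; exact: gO.
have mO := dvr_nonunits_submodule dO.
have pO := nonunits_prime rO mO.
have rA := sections_subring (chart pi V s g).
have [y Cy ey] := affine_point aC (prime_contraction rA AO pO).
have pP := affine_prime aC Cy.
have Oy : dominates O (stalk y).
  rewrite (affine_stalk aC Cy) ey in pP *.
  split=> f.
    move=> /localizationP[a [b [Aa Ab nb ->]]]; apply: subringM => //; first exact: AO.
    have [[]//|mb] := unit_nonunits (AO _ Ab); by case: nb.
  move=> /(nonunits_localizationP pP)[a [b [[ma Aa] Ab nb ->]]].
  apply: (submodMr mO) => //.
  have [[]//|mb] := unit_nonunits (AO _ Ab); by case: nb.
exists y => //; have Vy : V (pi y) by case: Cy.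
apply: (affine_inj aV) => //; rewrite /centre.
rewrite (dominates_centre Ox (sections_stalk Vx)).
by rewrite (dominates_centre (dominates_trans Oy (birational_dominates y)) (sections_stalk Vy)).
Qed.

End Projective.

(** * Rings essentially of finite type over the complex numbers *)

Section FiniteType.
Variables (R : realType) (K : fieldType) (iota : {rmorphism R[i] -> K}).
Implicit Types (O A : set K) (f g a b : K) (s : seq K).

Definition fin_gen s : set K := adjoin (range iota) [set` s].

(** The multiplicative set of [eft_ring] is replaced by the elements of [fin_gen s] that are units
    of [O]. The generators stay explicit because one [s] serves all points of an affine open, which
    makes the bounds on the canonical divisor uniform. *)
Definition ess_fin_by s O := fin_gen s `<=` O /\
  forall f, O f -> exists a b, [/\ fin_gen s a, fin_gen s b, unit_of O b & f = a / b].

Definition ess_fin O := exists s, ess_fin_by s O.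

Lemma scalars_subring : subring (range iota).
Proof.
split; first by exists 1 => //; rewrite rmorph1.
  by move=> _ _ [x _ <-] [y _ <-]; exists (x - y) => //; rewrite rmorphB.
by move=> _ _ [x _ <-] [y _ <-]; exists (x * y) => //; rewrite rmorphM.
Qed.

Lemma fin_gen_subring s : subring (fin_gen s).
Proof. exact: adjoin_subring. Qed.

Lemma fin_gen_noetherian s : noetherian (fin_gen s).
Proof.
apply: noetherian_adjoin; first exact: scalars_subring.
apply: noetherian_field scalars_subring _ => _ [x _ <-] x0.
by exists x^-1 => //; rewrite fmorphV.
Qed.

Lemma fin_gen_cat s1 s2 : fin_gen s1 `<=` fin_gen (s1 ++ s2).
Proof.
apply: adjoin_min; [exact: adjoin_subring|exact: adjoin_base|].
by move=> x /= xs; apply: adjoin_gen; rewrite /= mem_cat xs.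
Qed.

Lemma ess_fin_noetherian O : subring O -> ess_fin O -> noetherian O.
Proof.
move=> rO [s [sO fr]].
apply: (noetherian_fractions (fin_gen_subring s) rO sO) (@fin_gen_noetherian s).
by move=> f /fr [a [b [? ? ? ->]]]; exists a, b.
Qed.

Lemma ess_fin_eft O : subring O -> ess_fin O -> eft_ring iota O.
Proof.
move=> rO [s [sO fr]]; have rB := fin_gen_subring s.
exists s, [set b | fin_gen s b /\ unit_of O b]; split.
- by move=> b [].
- by split; [exact: (subring1 rB)|exact: (unit1 rO)].
- by move=> [_ []]; rewrite eqxx.
- by move=> f g [Bf uf] [Bg ug]; split; [exact: (subringM rB)|exact: (unitM rO)].
- apply/seteqP; split.
    by move=> f /fr [a [b [Ba Bb ub ->]]]; exists a => //; exists b.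
  move=> _ [a Ba [b [Bb [_ _ Obi]] <-]]; apply: subringM => //; exact: sO.
Qed.

Lemma eft_ess_fin O : subring O -> eft_ring iota O -> ess_fin O.
Proof.
move=> rO [s [S [SB S1 S0 SM e]]]; exists s.
have BO : fin_gen s `<=` O.
  by move=> b Bb; rewrite e; exists b => //; exists 1 => //; rewrite divr1.
split => // f; rewrite {1}e => -[a Aa [b Sb <-]].
exists a, b; split => //; first exact: SB.
split; [by apply/eqP => b0; apply: S0; rewrite -b0|exact: (BO _ (SB _ Sb))|].
rewrite e; exists 1; first exact: subring1 (fin_gen_subring _).
by exists b => //; rewrite div1r.
Qed.

Lemma ess_fin_localization s A (P : set K) : subring A -> prime_ideal A P ->
  ess_fin_by s A -> ess_fin_by s (localization A P).
Proof.
move=> rA pP [sA fr].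
have AL := localization_base rA pP; have rB := fin_gen_subring s.
split; first by move=> x /sA /AL.
move=> _ /localizationP[a [t [Aa At nt ->]]].
have [b [c [Bb Bc [c0 _ Aci] ->]]] := fr a Aa; have [b' [c' [Bb' Bc' [c'0 _ Aci'] tE]]] := fr t At.
have t0 := prime_neq0 pP nt.
have b'0 : b' != 0 by apply: contraNneq t0 => z; rewrite tE z mul0r.
exists (b * c'), (c * b'); split; [exact: (subringM rB)|exact: (subringM rB)| |].
  split; first by rewrite mulf_neq0.
    by apply/AL/sA; exact: (subringM rB).
  have -> : (c * b')^-1 = c^-1 * c'^-1 * t^-1 by rewrite tE; field; rewrite c0 c'0 b'0.
  apply: (subringM (localization_subring rA pP)); first by apply: AL; exact: (subringM rA).
  by apply/localizationP; exists 1, t; split; rewrite ?div1r //; exact: subring1.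
by rewrite tE; field; rewrite c0 c'0 b'0.
Qed.

Lemma ess_finite_stalk (X : int_scheme K) (x : X) : ess_finite_type iota X ->
  exists U, [/\ affine_open U, U x & ess_fin (sections U)].
Proof.
move=> [n [U [aU cov]]]; have [i Uix] := cov x; exists (U i).
have [? ?] := aU i; split => //; apply: eft_ess_fin => //; exact: sections_subring.
Qed.

Lemma ess_fin_stalk s (X : int_scheme K) (U : set X) (x : X) : affine_open U -> U x ->
  ess_fin_by s (sections U) -> ess_fin_by s (stalk x).
Proof.
move=> aU Ux eU; rewrite (affine_stalk aU Ux).
apply: ess_fin_localization => //; [exact: sections_subring|exact: affine_prime].
Qed.

(** The affine open [V] provided by projectivity may differ from those where finite type is known,
    so the argument stays in stalks: generators for [stalk (pi y)] are completed by the affine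
    coordinates [h / g] of the chart through [y]. *)
Lemma ess_fin_stalk_projective (Y X : int_scheme K) (pi : Y -> X) (y : Y) :
  birational_morphism pi -> projective pi ->
  ess_fin (stalk (pi y)) -> ess_fin (stalk y).
Proof.
move=> bpi [J _ /(_ (pi y))[V [s [[aV Vx] _ charts /(_ y Vx)]]]] [g [gs g0 Cy]].
have [aC eC] := charts g gs g0.
have [XY _] := birational_dominates bpi y.
move=> [r [rO fr]]; pose r' := r ++ [seq h / g | h <- s].
have rr' : fin_gen r `<=` fin_gen r' by exact: fin_gen_cat.
have ry := stalk_subring y; have rB := fin_gen_subring r'.
have r'O : fin_gen r' `<=` stalk y.
  apply: adjoin_min => //.
    by move=> x ?; apply/XY/rO; exact: adjoin_base.
  move=> x /=; rewrite mem_cat => /orP[xr|/mapP[h hs ->]]; last exact: (Cy.2).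
  by apply/XY/rO; exact: adjoin_gen.
have fC : forall f, sections (chart pi V s g) f ->
    exists a b, [/\ fin_gen r' a, fin_gen r' b, unit_of (stalk y) b & f = a / b].
  rewrite eC; apply: adjoin_min.
  - split.
    + by exists 1, 1; split; rewrite ?divr1 //; [exact: (subring1 rB)|exact: (subring1 rB)|exact: (unit1 ry)].
    + move=> _ _ [a [b [Ba Bb ub ->]]] [a' [b' [Ba' Bb' ub' ->]]].
      exists (a * b' - a' * b), (b * b'); split.
      * by apply: (subringB rB); exact: (subringM rB).
      * exact: (subringM rB).
      * exact: (unitM ry).
      * by case: ub => b0 _ _; case: ub' => b'0 _ _; field; rewrite b0 b'0.
    + move=> _ _ [a [b [Ba Bb ub ->]]] [a' [b' [Ba' Bb' ub' ->]]].
      exists (a * a'), (b * b'); split.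
      * exact: (subringM rB).
      * exact: (subringM rB).
      * exact: (unitM ry).
      * by case: ub => b0 _ _; case: ub' => b'0 _ _; field; rewrite b0 b'0.
  - move=> f /(sections_stalk Vx) /fr [a [b [Ba Bb ub ->]]]; exists a, b.
    by split => //; [exact: rr'|exact: rr'|exact: unit_of_sub ub].
  - move=> _ [h hs <-]; exists (h / g), 1; split; rewrite ?divr1 //.
    + apply: adjoin_gen => /=; rewrite mem_cat; apply/orP; right.
      by apply/mapP; exists h.
    + exact: (subring1 rB).
    + exact: (unit1 ry).
exists r'; split => // f; rewrite {1}(affine_stalk aC Cy).
move=> /localizationP[a [b [/fC[p [q [Bp Bq uq ->]]] Ab nb ->]]].
have [ub|mb] := unit_nonunits (sections_stalk Cy Ab); last by case: nb.
have [p' [q' [Bp' Bq' uq' bE]]] := fC _ Ab.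
have up' : unit_of (stalk y) p'.
  have -> : p' = b * q' by rewrite bE divfK //; case: uq'.
  exact: (unitM ry).
exists (p * q'), (q * p'); split; [exact: (subringM rB)|exact: (subringM rB)|exact: (unitM ry)|].
case: up' => p'0 _ _; case: uq => q0 _ _; case: uq' => q'0 _ _.
by rewrite bE; field; rewrite p'0 q0 q'0.
Qed.

Lemma ess_fin_local_domain (X : int_scheme K) (x : X) :
  ess_fin (stalk x) -> local_domain (stalk x).
Proof.
move=> ex; have rx := stalk_subring x; split => //.
- exact: stalk_local.
- exact: ess_fin_noetherian.
- exact: stalk_frac.
Qed.

End FiniteType.

(** * Finiteness of the zeros of a function in codimension one *)

Section Zeros.
Variables (K : fieldType) (X : int_scheme K) (U : set X).
Hypotheses (aU : affine_open U).

Lemma codim1_centre (x z : X) a : U x -> U z -> codim1 x ->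
  centre U z `<=` centre U x -> centre U z a -> a != 0 -> z = x.
Proof.
move=> Ux Uz cx zx za a0; apply: (affine_inj aU) => //.
have rA := sections_subring U.
have xz : stalk x `<=` stalk z.
  rewrite (affine_stalk aU Ux) (affine_stalk aU Uz).
  move=> f /localizationP[b [s [Ab As ns ->]]]; apply/localizationP.
  by exists b, s; split => // /zx.
have pz := nonunits_prime (stalk_subring z) (stalk_local z).
have [e|e] := cx.2 _ (prime_contraction (stalk_subring x) xz pz).
  suff : [set 0] a by move=> /eqP; rewrite (negbTE a0).
  by rewrite -e; split; [case: za|case: (zx _ za) => -[]].
apply/seteqP; split => // f [mf Af]; split => //.
by have : (nonunits (stalk z) `&` stalk x) f by [rewrite e]; case.
Qed.

(** Noetherian induction: an ideal containing [a] and maximal among those with infinitely many zeros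
    of codimension one is prime, because the zeros of a product are shared between its factors. But
    a nonzero prime has at most one such zero, its own point. *)
Lemma finite_zeros a : noetherian (sections U) -> sections U a -> a != 0 ->
  finite_set [set x | [/\ U x, codim1 x & nonunits (stalk x) a]].
Proof.
move=> nA Aa a0; apply: contrapT => inf.
have rA := sections_subring U.
pose Z (I : set K) := [set x : X | [/\ U x, codim1 x & I `<=` centre U x]].
pose F : set (set K) := [set I | [/\ I `<=` sections U, submodule (sections U) I,
  I a & ~ finite_set (Z I)]].
have Pm x : U x -> submodule (sections U) (centre U x).
  by move=> /(affine_prime aU)/prime_submodule.
have spanA (G : set K) : G `<=` sections U -> span (sections U) G `<=` sections U.
  by apply: span_min; exact: subring_submodule.
have [||I [IA mI Ia Iinf] Imax] := noetherian_max (F := F) nA.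
- exists (span (sections U) [set a]); split.
  + by apply: spanA => _ ->.
  + exact: span_submodule.
  + exact: span_gen.
  + apply: contra_not inf; apply: sub_finite_set => x [Ux cx xa]; split => //.
    by apply: span_min; [exact: Pm|move=> _ ->].
- by move=> J [].
have pI : prime_ideal (sections U) I.
  split => //.
    move=> I1; apply: Iinf; suff -> : Z I = set0 by [].
    by rewrite -subset0 => x [Ux _ /(_ 1 I1)]; apply: (prime_not1 (affine_prime aU Ux)).
  move=> f g Af Ag Ifg; apply: contrapT => /not_orP[nf ng].
  have fin h : sections U h -> ~ I h -> finite_set (Z (span (sections U) (I `|` [set h]))).
    move=> Ah nh; apply: contrapT => nfin; apply: nh.
    have hS : I `|` [set h] `<=` span (sections U) (I `|` [set h]) by exact: span_gen.
    apply: (Imax (span (sections U) (I `|` [set h]))); last by apply: hS; right.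
      split => //; last by apply: hS; left.
        by apply: spanA => x [/IA|->].
      exact: span_submodule.
    by move=> x Ix; apply: hS; left.
  apply: Iinf; apply: sub_finite_set (_ : finite_set (Z _ `|` Z _)); last first.
    by rewrite finite_setU; split; [exact: (fin f)|exact: (fin g)].
  move=> x [Ux cx Ix].
  by have [fx|gx] := primeM (affine_prime aU Ux) Af Ag (Ix _ Ifg); [left|right];
     split => //; apply: span_min; [exact: Pm|move=> h [/Ix|->]|exact: Pm|move=> h [/Ix|->]].
apply: Iinf; have [z Uz zI] := affine_point aU pI.
apply: sub_finite_set (finite_set1 z) => x [Ux cx Ix] /=.
by symmetry; apply: (codim1_centre (a := a)) => //; rewrite zI.
Qed.

End Zeros.

(** * Fekete's lemma under linear bounds *)

Section Fekete.
Variable R : realType.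

(** For [n = q * m + r], superadditivity bounds [a n] below by [q * a m + a r]; the linear lower
    bound controls [a r], and at [0] it gives [a 0 >= 0], from which the induction on [q] starts. *)
Lemma superadditive_limit (a : nat -> R) (c C : R) :
  (forall m n, a m + a n <= a (m + n)%N) ->
  (forall n, n%:R * c <= a n) -> (forall n, a n <= n%:R * C) ->
  exists L : R, [/\ (fun n => n%:R^-1 * a n) @ \oo --> L,
    forall m, (0 < m)%N -> a m <= m%:R * L
    & forall D, (forall m, (0 < m)%N -> a m <= m%:R * D) -> L <= D].
Proof.
move=> superadd lb ub.
pose E := [set n%:R^-1 * a n | n in [set n | (0 < n)%N]].
have pos n : (0 < n)%N -> 0 < n%:R :> R by rewrite ltr0n.
have ubE D : (forall m, (0 < m)%N -> a m <= m%:R * D) -> ubound E D.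
  by move=> h _ [n /= n0 <-]; rewrite mulrC ler_pdivrMr ?pos // mulrC; exact: h.
have supE : has_sup E.
  split; first by exists (1%:R^-1 * a 1%N), 1%N.
  by exists C; apply: ubE => m _.
have leL n : (0 < n)%N -> n%:R^-1 * a n <= sup E.
  by move=> n0; apply: (ub_le_sup supE.2); exists n.
exists (sup E); split.
- apply/cvgrPdist_le => e e0.
  have e2 : 0 < e / 2 by rewrite divr_gt0.
  have [_ [m /= m0 <-] tm] := sup_adherent e2 supE.
  set t := m%:R^-1 * a m in tm.
  have amt : a m = m%:R * t by rewrite /t mulVKf // gt_eqF ?pos.
  have mult q : q%:R * a m <= a (q * m)%N.
    elim: q => [|q IH]; first by have := lb 0%N; rewrite !mul0r mul0n.
    rewrite mulSn -natr1 mulrDl mul1r addrC.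
    by apply: le_trans (superadd _ _); rewrite lerD2l.
  near=> n.
  have n0 : (0 < n)%N by near: n; exists 1%N.
  (* Beyond this threshold the remainder terms [r * t] and [r * c] cost at most [n * e / 2]; the
     other half of [e] is the distance from [t] to the supremum. *)
  have nb : m%:R * (`|t| + `|c|) * (e / 2)^-1 <= n%:R.
    by near: n; exact: nbhs_infty_ger.
  rewrite ger0_norm ?subr_ge0 ?leL // lerBlDr -lerBlDl.
  rewrite mulrC ler_pdivlMr ?pos //.
  have := divn_eq n m; set q := (n %/ m)%N; set r := (n %% m)%N => nE.
  have rm : r%:R <= m%:R :> R by rewrite ler_nat ltnW // ltn_mod.
  have r0 : 0 <= r%:R :> R by [].
  have h1 := superadd (q * m)%N r; rewrite -nE in h1.
  have h2 := mult q; rewrite amt in h2; have h3 := lb r.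
  have nR : n%:R = q%:R * m%:R + r%:R :> R by rewrite nE natrD natrM.
  rewrite ler_pdivrMr // in nb.
  have t1 : r%:R * t <= m%:R * `|t|.
    apply: le_trans (_ : r%:R * `|t| <= _); first by rewrite ler_wpM2l // ler_norm.
    by rewrite ler_wpM2r.
  have c1 : - (m%:R * `|c|) <= r%:R * c.
    apply: le_trans (_ : - (r%:R * `|c|) <= _); first by rewrite lerN2 ler_wpM2r.
    by rewrite -mulrN ler_wpM2l // lerNl; rewrite -normrN ler_norm.
  have s1 : n%:R * (sup E - e / 2) <= n%:R * t by rewrite ler_wpM2l // ltW.
  have s2 : n%:R * t = q%:R * (m%:R * t) + r%:R * t by rewrite nR; ring.
  rewrite mulrDr in nb; lra.
- by move=> m m0; rewrite mulrC -ler_pdivrMr ?pos // mulrC leL.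
- by move=> D hD; apply: ge_sup; [case: supE|exact: ubE].
Unshelve. all: by end_near. Qed.

End Fekete.

(** * Local bounds for the canonical divisor *)

Section CanonicalBound.
Variables (R : realType) (K : fieldType) (iota : {rmorphism R[i] -> K}).
Variable w : top_form iota.
Implicit Types (f g a b : K) (O : set K).

Section Derivation.
Variables (d : K -> K) (dd : derivation iota d).

Lemma derivD f g : d (f + g) = d f + d g. Proof. by case: dd. Qed.
Lemma derivM f g : d (f * g) = d f * g + f * d g. Proof. by case: dd. Qed.
Lemma derivC c : d (iota c) = 0. Proof. by case: dd. Qed.
Lemma derivB f g : d (f - g) = d f - d g.
Proof. by apply/eqP; rewrite -subr_eq opprK -derivD subrK. Qed.
Lemma deriv_div f g : g != 0 -> d (f / g) = g^-1 * d f - (f / g ^+ 2) * d g.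
Proof.
move=> g0; have : d f = d (f / g) * g + f / g * d g by rewrite -derivM divfK.
by move=> ->; field.
Qed.

End Derivation.

Variable s : seq K.
Let B := fin_gen iota s.
Hypothesis fracB : forall f, exists a b, [/\ B a, B b, b != 0 & f = a / b].

Let rB : subring B. Proof. exact: fin_gen_subring. Qed.

Lemma common_denominator (r : seq K) : exists c, [/\ B c, c != 0 & forall x, x \in r -> B (c * x)].
Proof.
elim: r => [|x r [c [Bc c0 cr]]].
  by exists 1; split => //; [exact: (subring1 rB)|exact: oner_neq0].
have [a [b [Ba Bb b0 xE]]] := fracB x.
exists (b * c); split; [exact: (subringM rB)|by rewrite mulf_neq0|].
move=> y; rewrite inE => /orP[/eqP->|/cr h].
  have -> : b * c * x = c * a by rewrite xE; field.
  exact: (subringM rB).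
by rewrite -mulrA; exact: (subringM rB).
Qed.

(** [c] clears the denominators of the partial derivatives of the finitely many generators. The
    Leibniz and quotient rules carry this to fractions with unit denominators, so one [c] serves
    every [O]. *)
Lemma derivation_denominator : exists c, [/\ B c, c != 0 &
  forall O, subring O -> B `<=` O ->
  (forall f, O f -> exists a b, [/\ B a, B b, unit_of O b & f = a / b]) ->
  forall a j, O a -> O (c * @fpartial _ _ _ w j a)].
Proof.
have [c [Bc c0 cs]] := common_denominator [seq fpartial j l | l <- s, j <- enum 'I_(fdim w)].
exists c; split => // O rO BO fr.
have dB : forall a, B a -> B a /\ forall j : 'I_(fdim w), B (c * fpartial j a).
  apply: adjoin_min.
  - split.
    + split; first exact: (subring1 rB).
      move=> j; rewrite -(rmorph1 iota) (derivC (fpartial_derivation j)) mulr0.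
      exact: (subring0 rB).
    + move=> f g [Bf hf] [Bg hg]; split; first exact: (subringB rB).
      by move=> j; rewrite (derivB (fpartial_derivation j)) mulrBr; apply: (subringB rB).
    + move=> f g [Bf hf] [Bg hg]; split; first exact: (subringM rB).
      move=> j; rewrite (derivM (fpartial_derivation j)) mulrDr mulrA [c * (f * _)]mulrCA.
      by apply: (subringD rB); apply: (subringM rB).
  - move=> _ [x _ <-]; split; first by apply: adjoin_base; exists x.
    by move=> j; rewrite (derivC (fpartial_derivation j)) mulr0; exact: (subring0 rB).
  - move=> x /= xs; split; first exact: adjoin_gen.
    move=> j; apply: cs; apply/allpairsP; exists (x, j); split => //=.
    by rewrite mem_enum.
move=> x j /fr [a [b [/dB[Ba da] /dB[Bb db] [b0 Ob Obi] ->]]].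
rewrite (deriv_div (fpartial_derivation j)) //.
have -> : c * (b^-1 * fpartial j a - a / b ^+ 2 * fpartial j b) =
  b^-1 * (c * fpartial j a) - a * b^-1 * b^-1 * (c * fpartial j b) by field.
apply: (subringB rO); first by apply: (subringM rO) => //; exact: BO.
apply: (subringM rO); last exact: BO.
by do 2!apply: (subringM rO) => //; exact: BO.
Qed.

(* Clear the denominators of the coordinates one at a time: the Jacobian is
   linear in each [d x_i], and [d (p / q)] is a combination of [dp] and [dq]. *)
Lemma nonzero_jacobian : exists b : 'I_(fdim w) -> K,
  (forall i, B (b i)) /\ jacobian b != 0.
Proof.
suff H k : (k <= fdim w)%N -> exists b : 'I_(fdim w) -> K,
    (forall i : 'I_(fdim w), (i < k)%N -> B (b i)) /\ jacobian b != 0.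
  have [b [hb jb]] := H (fdim w) (leqnn _); exists b; split => // i; exact: hb.
elim: k => [_|k IH kn].
  exists (@fcoord _ _ _ w); split => //; rewrite /jacobian.
  rewrite (_ : \matrix_(i, j) _ = 1%:M) ?det1 ?oner_neq0 //.
  by apply/matrixP => i j; rewrite !mxE fpartial_coord.
have [b [hb jb]] := IH (ltnW kn).
pose i0 := Ordinal kn; have [p [q [Bp Bq q0 bE]]] := fracB (b i0).
pose upd x i := if i == i0 then x else b i.
have updP x : B x -> forall i : 'I_(fdim w), (i < k.+1)%N -> B (upd x i).
  move=> Bx i; rewrite /upd; case: eqP => // ni; rewrite ltnS leq_eqVlt => /orP[/eqP e|].
    by case: ni; apply: val_inj.
  exact: hb.
have rowE x : row' i0 (\matrix_(i, j) fpartial j (upd x i)) =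
    row' i0 (\matrix_(i, j) fpartial j (b i)).
  by apply/matrixP => i j; rewrite !mxE /upd eq_sym (negbTE (neq_lift _ _)).
have e : jacobian b = q^-1 * jacobian (upd p) + - (p / q ^+ 2) * jacobian (upd q).
  apply: (@determinant_multilinear _ _ _ _ _ i0) => //.
  apply/matrixP => i j; rewrite !mxE /upd eqxx bE.
  by rewrite (deriv_div (fpartial_derivation j)) // mulNr.
have [jp|jp] := eqVneq (jacobian (upd p)) 0; last by exists (upd p); split => //; exact: updP.
have [jq|jq] := eqVneq (jacobian (upd q)) 0; last by exists (upd q); split => //; exact: updP.
by move: jb; rewrite e jp jq !mulr0 addr0 eqxx.
Qed.

(** An element of least order generates; multiplication by [c] turns the orders into natural
    numbers. *)
Lemma dvr_submodule_principal O (M : set K) c : dvr O -> submodule O M ->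
  c != 0 -> (forall x, M x -> O (c * x)) -> (exists2 x, M x & x != 0) ->
  exists m, M = [set u * m | u in O].
Proof.
move=> dO mM c0 cM [x0 Mx0 x00].
pose P n := `[< exists x, [/\ M x, x != 0 & ord O (c * x) = n%:Z] >].
have ordE x : M x -> x != 0 -> exists n : nat, ord O (c * x) = n%:Z.
  move=> Mx x0n; have := (ord_ge0 dO (mulf_neq0 c0 x0n)).1 (cM _ Mx).
  by case: (ord O _) => // n _; exists n.
have exP : exists n, P n.
  by have [n e] := ordE _ Mx0 x00; exists n; apply/asboolP; exists x0.
case: (ex_minnP exP) => k /asboolP[m [Mm m0 me]] kmin.
exists m; apply/seteqP; split; last first.
  by move=> _ [u Ou <-]; exact: (submodM mM).
move=> x Mx; exists (x / m); last by rewrite divfK.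
have [->|x0'] := eqVneq x 0; first by rewrite mul0r; exact: subring0 (dvr_subring dO).
apply/(ord_ge0 dO); first by rewrite mulf_neq0 // invr_eq0.
have [n e] := ordE _ Mx x0'.
have kn : (k <= n)%N by apply: kmin; apply/asboolP; exists x.
move: e me; rewrite !(ordM dO) ?invr_eq0 // (ordV dO) // => e me.
by rewrite subr_ge0 -(lerD2l (ord O c)) e me lez_nat.
Qed.

(** The module of regular coefficients is squeezed: it contains the fixed [jacobian b], and [c ^+ n]
    sends it into [O], each of the [n] rows of a Jacobian costing one factor [c]. Its generator is
    thus bounded on both sides by elements independent of [O], whence [h1] and [h2]. *)
Lemma ord_form_bounds : exists h1 h2, [/\ h1 != 0, h2 != 0 &
  forall O, dvr O -> B `<=` O ->
  (forall f, O f -> exists a b, [/\ B a, B b, unit_of O b & f = a / b]) ->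
  ord O h1 <= ord_form w O <= ord O h2].
Proof.
have [c [Bc c0 cd]] := derivation_denominator.
have [b [Bb jb]] := nonzero_jacobian.
set n := fdim w in b Bb jb *.
exists (fcoef w / jacobian b), (fcoef w * c ^+ n); split.
- by rewrite mulf_neq0 ?invr_eq0 ?fcoef_neq0.
- by rewrite mulf_neq0 ?expf_neq0 ?fcoef_neq0.
move=> O dO BO fr; have rO := dvr_subring dO.
have cn0 : c ^+ n != 0 by rewrite expf_neq0.
have regO x : regular_coefs w O x -> O (c ^+ n * x).
  move: x; apply: span_min.
    split; first by rewrite /= mulr0; exact: (subring0 rO).
      by move=> x y Ox Oy; rewrite /= mulrDr; exact: (subringD rO).
    by move=> a x Oa Ox; rewrite /= mulrCA; exact: (subringM rO).
  move=> _ [a aO <-] /=; rewrite /jacobian -detZ; apply: (subring_det rO) => i j.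
  by rewrite !mxE; apply: cd => //; exact: aO.
have regj : regular_coefs w O (jacobian b) by apply: span_gen; exists b => // i; exact: (BO _ (Bb i)).
have [|m mE] := dvr_submodule_principal dO (span_submodule O _) cn0 regO.
  by exists (jacobian b).
rewrite /ord_form.
(* A generator exists, so the [xget] in [ord_form] does not return its default [0]. *)
have := @xgetPex K 0 [set c | regular_coefs w O = [set u * c | u in O]] (ex_intro _ m mE).
move: (xget _ _) => m' /= m'E.
have [u Ou jE] : [set u * m' | u in O] (jacobian b) by rewrite -m'E.
have m'0 : m' != 0 by apply: contraNneq jb => z; rewrite -jE z mulr0.
have u0 : u != 0 by apply: contraNneq jb => z; rewrite -jE z mul0r.
have Om' : O (c ^+ n * m').
  by apply: regO; rewrite m'E; exists 1; [exact: (subring1 rO)|rewrite mul1r].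
have f0 := fcoef_neq0 w.
rewrite !(ordM dO) ?invr_eq0 // !(ordV dO) // lerD2l lerD2l lerN2; apply/andP; split.
  rewrite -jE (ordM dO) // lerDr; exact/(ord_ge0 dO).
rewrite -subr_ge0 opprK -(ordM dO) //; apply/(ord_ge0 dO) => //.
by rewrite mulf_neq0.
Qed.

End CanonicalBound.

(** * The spectrum of a discrete valuation ring *)

(* [false] is the closed point, [true] the generic point. *)
Definition sierpinski := bool.
HB.instance Definition _ := Choice.on sierpinski.

Definition sierpinski_open : set_system sierpinski := [set U | U false -> U true].

Lemma sierpinski_openT : sierpinski_open setT. Proof. by []. Qed.
Lemma sierpinski_openI : setI_closed sierpinski_open.
Proof. by move=> U V hU hV [/hU ? /hV ?]; split. Qed.
Lemma sierpinski_open_bigU (I : Type) (f : I -> set sierpinski) :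
  (forall i, sierpinski_open (f i)) -> sierpinski_open (\bigcup_i f i).
Proof. by move=> h [i _ /h ?]; exists i. Qed.

HB.instance Definition _ := isOpenTopological.Build sierpinski
  sierpinski_openT sierpinski_openI sierpinski_open_bigU.

Lemma sierpinski_openP (V : set sierpinski) : open V <-> (V false -> V true).
Proof. by []. Qed.

Section SpecDVR.
Variables (K : fieldType) (O : set K) (dO : dvr O).

Definition spec_stalk (b : sierpinski) : set K := if b then setT else O.

Lemma nonunitsT : nonunits (setT : set K) = [set 0].
Proof.
apply/seteqP; split; last by move=> _ ->; split => // -[]; rewrite eqxx.
by move=> f [_ nf] /=; apply/eqP; apply: contrapT => /negP f0; apply: nf.
Qed.

Lemma subringT : subring (setT : set K). Proof. by []. Qed.

Lemma spec_stalk_subring b : subring (spec_stalk b).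
Proof. by case: b => /=; [exact: subringT|exact: dvr_subring]. Qed.

Lemma spec_sections : sections_of spec_stalk setT = O.
Proof.
apply/seteqP; split; first by move=> f /(_ false I).
by move=> f Of [].
Qed.

Lemma spec_affine : affine_on spec_stalk setT.
Proof.
rewrite /affine_on spec_sections; have rO := dvr_subring dO.
have [t [[Ot et] t0 _ tP]] := ord_spec dO.
have mO := dvr_nonunits_submodule dO; have pO := nonunits_prime rO mO.
have capO : nonunits O `&` O = nonunits O.
  by apply/seteqP; split => [f []//|f mf]; split => //; case: mf.
have capT : nonunits setT `&` O = [set 0].
  rewrite nonunitsT; apply/seteqP; split => [f []//|_ ->]; split => //.
  exact: subring0 rO.
have fracO f : exists a b, [/\ O a, O b, b != 0 & f = a / b].
  have [Of|Of] := dvr_total dO f.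
    exists f, 1; split => //; [exact: (subring1 rO)|exact: oner_neq0|by rewrite divr1].
  have [->|f0] := eqVneq f 0.
    by exists 0, 1; split; [exact: (subring0 rO)|exact: (subring1 rO)|exact: oner_neq0|rewrite mul0r].
  exists 1, f^-1; split => //; [exact: (subring1 rO)|by rewrite invr_eq0|by rewrite div1r invrK].
have p0 : prime_ideal O [set 0].
  split.
  - by move=> _ ->; exact: (subring0 rO).
  - split => //; first by move=> _ _ -> ->; rewrite /= addr0.
    by move=> a _ _ ->; rewrite /= mulr0.
  - by move=> /eqP; rewrite oner_eq0.
  - by move=> f g _ _ /= /eqP; rewrite mulf_eq0 => /orP[] /eqP; [left|right].
have nt : nonunits O t by rewrite et; exists 1; [exact: (subring1 rO)|rewrite mulr1].
split.
- exact: openT.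
- apply/seteqP; split => // f _; have [a [b [Oa Ob b0 ->]]] := fracO f.
  by exists a => //; exists b => //; split => //; exact/eqP.
- case=> _ /=.
    rewrite capT; split => //; apply/seteqP; split => // f _; apply/localizationP.
    have [a [b [Oa Ob b0 fE]]] := fracO f.
    by exists a, b; split => //= /eqP; rewrite (negbTE b0).
  rewrite capO; split => //; apply/seteqP; split; first exact: localization_base.
  move=> _ /localizationP[a [b [Oa Ob nb ->]]]; apply: (subringM rO) => //.
  by have [[]//|] := unit_nonunits Ob.
- move=> P pP; have [->|->] := (dvr_dim1 dO).2 P pP.
    exists true; split; first by split.
    case=> // -[_] /=; rewrite capO => e; move: nt; rewrite e => /eqP.
    by rewrite (negbTE t0).
  exists false; split; first by split.
  case=> // -[_] /=; rewrite capT => e; move: nt; rewrite -e => /eqP.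
  by rewrite (negbTE t0).
- move=> V _; split.
    (* The three open sets: [[set 1]] cuts out the whole space, [[set t]] the generic point, [set0]
       the empty set. *)
    move=> oV; have [Vf|nVf] := pselect (V false).
      exists [set 1]; first by move=> _ ->; exact: (subring1 rO).
      apply/seteqP; split => b.
        move=> _; split => // /(_ 1 erefl).
        case: b => h1.
          have : (nonunits setT `&` O) 1 := h1.
          by rewrite capT /= => /eqP; rewrite oner_eq0.
        by have [[_ []]] := h1; exact: unit1.
      by move=> _; case: b => //; exact: oV.
    have [Vt|nVt] := pselect (V true).
      exists [set t]; first by move=> _ ->.
      apply/seteqP; split; case=> //.
        move=> _; split => // /(_ t erefl) ht.
        have : (nonunits setT `&` O) t := ht.
        by rewrite capT => /eqP; rewrite (negbTE t0).
      by move=> [_ []] _ ->.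
    exists set0 => //; apply/seteqP; split; first by case.
    by move=> b [_ []].
  move=> [I _ ->]; apply/sierpinski_openP => -[_ nI]; split => // h; apply: nI => f /h hf.
  have : (nonunits setT `&` O) f := hf.
  rewrite capT => ->; split; [exact: submod0 mO|exact: (subring0 rO)].
Qed.

Lemma spec_irreducible (U V : set sierpinski) : open U -> open V ->
  U !=set0 -> V !=set0 -> U `&` V !=set0.
Proof.
have gen (A : set sierpinski) : open A -> A !=set0 -> A true.
  by move=> oA [[]//]; exact: oA.
by move=> oU oV U0 V0; exists true; split; exact: gen.
Qed.

Definition spec_dvr : int_scheme K := @IntScheme K sierpinski spec_stalk
  spec_stalk_subring (ex_intro _ true I) spec_irreducible
  (fun x => ex_intro2 _ _ _ spec_affine I).

End SpecDVR.

(** * The equivalences *)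

Section Equivalence.
Variables (R : realType) (K : fieldType) (iota : {rmorphism R[i] -> K}).
Variables (W : int_scheme K) (w : top_form iota).
Hypotheses (W_normal : normal W) (W_eft : ess_finite_type iota W).
Implicit Types (M : model W) (f g h : K) (U : set W).

Let KW : wdiv R W := canonical_div w (X := W).
Local Notation KE M := (wadd (canonical_div w (X := (M : model W))) (exc_div R M)).

Lemma base_ess_fin (x : W) : ess_fin iota (stalk x).
Proof.
have [U [aU Ux [s sU]]] := ess_finite_stalk x W_eft.
by exists s; exact: ess_fin_stalk sU.
Qed.

Lemma base_local (x : W) : local_domain (stalk x).
Proof. exact/ess_fin_local_domain/base_ess_fin. Qed.

Lemma model_ess_fin M (y : M) : ess_fin iota (stalk y).
Proof.
exact: ess_fin_stalk_projective (mmap_birational M) (mmap_projective M) (base_ess_fin _).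
Qed.

Lemma model_local M (y : M) : local_domain (stalk y).
Proof. exact/ess_fin_local_domain/model_ess_fin. Qed.

Lemma base_dvr (F : pdiv W) : dvr (stalk (F : W)).
Proof. exact (codim1_dvr W_normal base_local (gpoint_codim1 F)). Qed.

Lemma model_dvr M (E : pdiv M) : dvr (stalk (E : M)).
Proof. exact (codim1_dvr (@mnormal _ _ M) (@model_local M) (gpoint_codim1 E)). Qed.

Lemma model_dominates M (y : M) : dominates (stalk y) (stalk (mmap y)).
Proof. exact: birational_dominates (mmap_birational M) y. Qed.

(** The valuative criterion is applied to the local ring of [F] itself; the stalk at the point found
    lies between the stalk at its image and the local ring of [F], which coincide. *)
Lemma strict_transform M (F : pdiv W) :
  exists E : pdiv M, mmap (E : M) = F :> W /\ stalk (E : M) = stalk (F : W).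
Proof.
have FF : dominates (stalk (F : W)) (stalk (F : W)) by split.
have [y yF Fy] := valuative_criterion (mmap_birational M) (mmap_projective M) (base_dvr F) FF.
have e : stalk y = stalk (F : W).
  apply/seteqP; split; first exact: Fy.1.
  by rewrite -yF; exact: (model_dominates y).1.
have cy : codim1 y by rewrite /codim1 e; exact: gpoint_codim1.
by exists (PDiv cy).
Qed.

Lemma codim1_image_stalk M (E : pdiv M) : codim1 (mmap (E : M)) ->
  stalk (mmap (E : M)) = stalk (E : M).
Proof.
move=> c; have [sE mE] := model_dominates (E : M).
apply/seteqP; split => //; exact: (dvr_maximal (base_dvr (PDiv c)) sE mE).
Qed.

Lemma exc_div_codim1 M (E : pdiv M) : codim1 (mmap (E : M)) -> exc_div R M E = 0.
Proof. by move=> c; rewrite /exc_div /exceptional asboolF //; apply. Qed.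

Lemma pushforward_sub M m U :
  div_sections (wscale m (KE M)) (@mmap K W M @^-1` U) `<=` div_sections (wscale m KW) U.
Proof.
move=> f [->|hf]; [by left|right] => F UF.
have [E [EF sE]] := strict_transform M F.
have := hf E; rewrite /= EF sE => /(_ UF).
rewrite /wscale /wadd exc_div_codim1 ?addr0; last by rewrite EF; exact: gpoint_codim1.
by rewrite /KW /canonical_div sE.
Qed.

Lemma ess_fin_frac (U : set W) s : affine_open U -> ess_fin_by iota s (sections U) ->
  forall f, exists a b, [/\ fin_gen iota s a, fin_gen iota s b, b != 0 & f = a / b].
Proof.
move=> aU [sU fr] f; have rB := fin_gen_subring iota s.
have [a [b [/fr[p [q [Bp Bq [q0 _ _] ->]]] /fr[p' [q' [Bp' Bq' [q'0 _ _] ->]]] b0 ->]]] := affine_frac aU f.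
have p'0 : p' != 0 by apply: contraNneq b0 => ->; rewrite mul0r.
exists (p * q'), (q * p'); split; [exact: (subringM rB)|exact: (subringM rB)| |].
  by rewrite mulf_neq0.
by field; rewrite p'0 q0 q'0.
Qed.

Lemma canonical_bounded (x : W) : exists U h1 h2, [/\ open U, U x, h1 != 0, h2 != 0 &
  forall F : pdiv W, U F ->
    (ord (stalk (F : W)) h1)%:~R <= KW F <= (ord (stalk (F : W)) h2)%:~R].
Proof.
have [U [aU Ux [s sU]]] := ess_finite_stalk x W_eft.
have [h1 [h2 [h10 h20 hb]]] := ord_form_bounds w (ess_fin_frac aU sU).
exists U, h1, h2; split => //; first exact: affine_is_open aU.
move=> F UF; rewrite /KW /canonical_div !ler_int.
have [sF fr] := ess_fin_stalk aU UF sU.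
by apply: hb => //; exact: base_dvr.
Qed.

Lemma div_sectionsP (X : int_scheme K) (D : wdiv R X) (U : set X) f (E : pdiv X) :
  f != 0 -> div_sections D U f -> U E -> 0 <= (ord (stalk (E : X)) f)%:~R + D E.
Proof. by move=> f0 [e|]; [rewrite e eqxx in f0|apply]. Qed.

(** * The nef envelope as a supremum *)

Section Envelope.
Variables (M : model W) (E : pdiv M).
Let x : W := mmap (E : M).
Let dE := model_dvr E.
Let v f : R := (ord (stalk (E : M)) f)%:~R.
Let S m : set K := [set g | div_stalk (wscale m KW) x g /\ g != 0].

Lemma nef_envelope_spec :
  (forall m g, (0 < m)%N -> S m g -> - v g <= m%:R * nef_envelope KW M E) /\
  (forall D, (forall m g, (0 < m)%N -> S m g -> - v g <= m%:R * D) ->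
     nef_envelope KW M E <= D).
Proof.
have [U [h1 [h2 [oU Ux h10 h20 hb]]]] := canonical_bounded x.
(* [h1 ^- m] is a section because the divisor of [h1] is at most [KW]. Together with the lower bound
   [lbS] it makes [inf] a genuine infimum rather than a default value. *)
have Sh1 m : S m (h1 ^- m).
  split; last by rewrite invr_eq0 expf_neq0.
  exists U; split => //; right => F UF; have /andP[h _] := hb F UF.
  rewrite (ordV (base_dvr F)) ?expf_neq0 // (ordX (base_dvr F)) // intrN intrM.
  by rewrite addrC subr_ge0 ler_wpM2l.
have vh1 m : v (h1 ^- m) = - (m%:R * v h1).
  by rewrite /v (ordV dE) ?expf_neq0 // (ordX dE) // intrN intrM.
have lbS m g : S m g -> - (m%:R * v h2) <= v g.
  move=> [[U' [oU' U'x hg]] g0].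
  have gh0 : g * h2 ^+ m != 0 by rewrite mulf_neq0 ?expf_neq0.
  have : stalk x (g * h2 ^+ m).
    apply: (hartogs W_normal base_local (openI oU' oU)) => // F [U'F UF].
    apply/(ord_ge0 (base_dvr F)) => //.
    rewrite (ordM (base_dvr F)) ?expf_neq0 // (ordX (base_dvr F)) //.
    rewrite -(ler_int R) intrD intrM; apply: le_trans (div_sectionsP g0 hg U'F) _.
    by rewrite lerD2l ler_wpM2l //; have /andP[] := hb F UF.
  move=> /(model_dominates (E : M)).1 /(ord_ge0 dE gh0).
  rewrite (ordM dE) ?expf_neq0 // (ordX dE) //.
  by rewrite -(ler_int R) intrD intrM -lerBlDr sub0r.
have SM m n f g : S m f -> S n g -> S (m + n)%N (f * g).
  move=> [[U1 [oU1 U1x hf]] f0] [[U2 [oU2 U2x hg]] g0]; split; last by rewrite mulf_neq0.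
  exists (U1 `&` U2); split; [exact: openI|by []|right => F [U1F U2F]].
  rewrite (ordM (base_dvr F)) // intrD /wscale natrD mulrDl addrACA.
  by apply: addr_ge0; [exact: div_sectionsP hf U1F|exact: div_sectionsP hg U2F].
pose a m : R := - inf [set v g | g in S m].
have lbV m : has_lbound [set v g | g in S m].
  by exists (- (m%:R * v h2)) => _ [g Sg <-]; exact: lbS.
have aS m g : S m g -> - v g <= a m.
  by move=> Sg; rewrite /a lerN2; apply: ge_inf => //; exists g.
have aD m D : (forall g, S m g -> - v g <= D) -> a m <= D.
  move=> h; rewrite /a lerNl; apply: lb_le_inf; first by exists (v (h1 ^- m)), (h1 ^- m).
  by move=> _ [g Sg <-]; rewrite lerNl; exact: h.
have [m n|m|m|L [cvL leL Lle]] := @superadditive_limit R a (v h1) (v h2).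
- rewrite -lerBrDr; apply: (aD) => f Sf; rewrite lerBrDr addrC -lerBrDr.
  apply: (aD) => g Sg; rewrite lerBrDr addrC -opprD -intrD -(ordM dE); [|by case: Sf|by case: Sg].
  by apply: (aS); exact: SM.
- by apply: le_trans (aS _ _ (Sh1 m)); rewrite vh1 opprK.
- by apply: (aD) => g /lbS; rewrite lerNl.
have -> : nef_envelope KW M E = L by apply: cvg_lim.
split; first by move=> m g m0 Sg; apply: le_trans (aS _ _ Sg) (leL m m0).
by move=> D hD; apply: Lle => m m0; apply: (aD) => g; exact: hD.
Qed.

End Envelope.

Lemma valuative_lc_pushforward : valuative_lc W w <-> pluricanonical_pushforward W w.
Proof.
split.
  move=> vlc M m m0 U oU; apply/seteqP; split; first exact: pushforward_sub.
  move=> f hf; have [->|f0] := eqVneq f 0; [by left|right => E UE].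
  have := (nef_envelope_spec E).1 m f m0 (conj (ex_intro _ U (And3 oU UE hf)) f0).
  have := vlc M E; rewrite /= subr_ge0 => hE hf'.
  rewrite -lerBlDl sub0r; apply: le_trans hf' _.
  by rewrite /wscale ler_wpM2l.
move=> push M E; rewrite /= subr_ge0.
apply: (nef_envelope_spec E).2 => m g m0 [[U [oU Ux hg]] g0].
rewrite -(push M m m0 U oU) in hg.
by have := div_sectionsP (E := E) g0 hg Ux; rewrite -lerBlDl sub0r.
Qed.

End Equivalence.

(** * Divisors on the log canonical model *)

Section LogCanonicalModel.
Variables (R : realType) (K : fieldType) (iota : {rmorphism R[i] -> K}).
Variables (W : int_scheme K) (w : top_form iota).
Hypotheses (W_normal : normal W) (W_eft : ess_finite_type iota W).
Implicit Types (M : model W) (f g h : K) (U : set W).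

Let KW : wdiv R W := canonical_div w (X := W).
Local Notation KE M := (wadd (canonical_div w (X := (M : model W))) (exc_div R M)).
Let base_local := base_local W_eft.
Let base_dvr := base_dvr W_normal W_eft.
Let model_dvr := model_dvr W_eft.
Let model_local := model_local W_eft.

Lemma iso_in_codim1_pushforward (Y : model W) : log_canonical w (exc_div R Y) ->
  iso_in_codim1 Y -> pluricanonical_pushforward W w.
Proof.
move=> [[m1 m10 cart] disc] iso M m m0 U oU.
apply/seteqP; split; first exact: pushforward_sub.
move=> f hf; have [->|f0] := eqVneq f 0; [by left|right => E UE].
have isoY (F : pdiv Y) : codim1 (mmap (F : Y)) by apply: contrapT; exact: iso F.
have dE := model_dvr E.
(* A non-exceptional [E] has coefficient [0] in the exceptional divisor, so the discrepancy bound
   [-1] would not suffice; the inequality is read off on [W] instead. *)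
have [cE|ncE] := pselect (codim1 (mmap (E : M))).
  have := div_sectionsP (E := PDiv cE) f0 hf UE.
  rewrite /wscale /wadd exc_div_codim1 // addr0 /canonical_div /=.
  by rewrite (codim1_image_stalk W_normal W_eft cE).
have [y yE Ey] := valuative_criterion (mmap_birational Y) (mmap_projective Y) dE
  (model_dominates (E : M)).
have [h [h0 [U1 [oU1 U1y hU1]]]] := cart y.
(* Near [y], [h] is an equation of [m1 * K_Y], and every prime divisor of [Y] has the local ring of
   a prime divisor of [W]; hence [f ^+ m1 * h ^+ m] has nonnegative order in codimension one. *)
have g0 : f ^+ m1 * h ^+ m != 0 by rewrite mulf_neq0 ?expf_neq0.
have yg : stalk y (f ^+ m1 * h ^+ m).
  have oU' := preimage_open (mmap_birational Y) oU.
  apply: (hartogs (@mnormal _ _ Y) (@model_local Y) (openI oU1 oU')).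
    by split => //; rewrite /= yE.
  move=> G [U1G UG]; have dG := model_dvr G; apply/(ord_ge0 dG) => //.
  rewrite (ordM dG) ?expf_neq0 // !(ordX dG) // -(ler_int R) intrD !intrM.
  have := div_sectionsP (E := PDiv (isoY G)) f0 hf UG.
  rewrite -(hU1 G U1G) /wscale /wadd exc_div_codim1 // addr0 /KW /canonical_div /=.
  rewrite (codim1_image_stalk W_normal W_eft (isoY G)) => hG.
  have := mulr_ge0 (ler0n R m1) hG; rewrite mulrDr mulrCA.
  by [].
have [eta [etaT etaU]] := generic_point Y.
pose phi (b : spec_dvr dE) : Y := if b then eta else y.
have bphi : birational_morphism phi.
  split; last by case; [rewrite /phi etaT; split|exact: Ey].
  apply/continuousP => A oA; apply/sierpinski_openP => /= Ay.
  by apply: etaU => //; exists y.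
have nZ : normal (spec_dvr dE).
  by case=> [f' p _ _ _ //|]; exact: (@mnormal _ _ M (E : M)).
have eZ : ess_finite_type iota (spec_dvr dE).
  exists 1%N, (fun=> setT); split; last by move=> z; exists ord0.
  move=> _; split; first exact: spec_affine.
  rewrite /sections spec_sections; apply: ess_fin_eft; first exact: dvr_subring.
  exact: model_ess_fin.
pose F := @PDiv K (spec_dvr dE) false (dvr_dim1 dE).
have le : local_equation (wscale m1 (KE Y)) (phi F) h by split => //; exists U1.
have := disc _ phi nZ eZ bphi F m1 h m10 le.
rewrite /canonical_div /wscale /wadd /= => hF.
have m1p : 0 < m1%:R :> R by rewrite ltr0n.
have : (0 : R) <= m1%:R * (ord (stalk (E : M)) f)%:~R + m%:R * (ord (stalk (E : M)) h)%:~R.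
  have := (ord_ge0 dE g0).1 (Ey.1 _ yg).
  by rewrite (ordM dE) ?expf_neq0 // !(ordX dE) // -(ler_int R) intrD !intrM.
(* The coefficient [1] of an exceptional [E] offsets the discrepancy bound [-1]:
   [oh / m1 <= k + 1]. *)
rewrite /exc_div asboolT //=.
move: hF; set o := (ord _ f)%:~R; set oh := (ord _ h)%:~R; set k := (ord_form w _)%:~R.
move=> hF hg; rewrite -(pmulr_rge0 _ m1p) mulrDr.
apply: le_trans hg _; rewrite lerD2l mulrCA ler_wpM2l //.
have -> : oh = m1%:R * (oh / m1%:R) by rewrite mulrC divfK // gt_eqF.
rewrite ler_pM2l //; lra.
Qed.

(** Only at the finitely many zeros of [c] is the order positive. *)
Lemma bounded_ord (V : set W) c : affine_open V -> noetherian (sections V) ->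
  sections V c -> c != 0 ->
  exists k : nat, forall F : pdiv W, V F -> ord (stalk (F : W)) c <= k%:Z.
Proof.
move=> aV nV Vc c0; have /finite_seqP[l lE] := finite_zeros aV nV Vc c0.
exists (\max_(x <- l) `|ord (stalk x) c|%N) => F VF; have dF := base_dvr F.
have [Fc|Fc] := unit_nonunits (sections_stalk VF Vc).
  rewrite (_ : ord _ c = 0) //; apply/eqP; rewrite eq_le; apply/andP; split.
    by rewrite leNgt; apply/negP => /(ord_gt0 dF c0) [].
  by apply/(ord_ge0 dF c0); exact: sections_stalk VF _ Vc.
have Fl : (F : W) \in l.
  have : [set` l] (F : W) by rewrite -lE; split => //; exact: gpoint_codim1.
  by [].
apply: le_trans (ler_norm _) _; rewrite -abszE lez_nat.
exact: (leq_bigmax_seq (F := fun x : W => `|ord (stalk x) c|%N) _ Fl).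
Qed.

(** * A function with a pole along an exceptional divisor *)

Section Exceptional.
Variables (Y : model W) (V : set W) (T : set Y) (E0 : pdiv Y).
Hypotheses (aV : affine_open V) (nV : noetherian (sections V)).
Hypotheses (aT : affine_open T) (TV : T `<=` @mmap K W Y @^-1` V).
Hypotheses (TE : T E0) (excE : exceptional E0).

Lemma centre_nonzero (F : pdiv Y) : T F -> exists2 t, centre T F t & t != 0.
Proof.
move=> TF; have [t [[Ot et] t0 _ _]] := ord_spec (model_dvr F).
have : nonunits (stalk (F : Y)) t.
  by rewrite et; exists 1; [exact: subring1 (stalk_subring _)|rewrite mulr1].
rewrite (affine_stalk aT TF).
move=> /(nonunits_localizationP (affine_prime aT TF))[a [s [Pa _ _ tE]]].
by exists a => //; apply: contraNneq t0 => a0; rewrite tE a0 mul0r.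
Qed.

(** Distinct primes of height one do not contain each other, and [F] differs from [E0] since it is
    not exceptional. *)
Lemma separate (F : pdiv Y) : T F -> codim1 (mmap (F : Y)) ->
  exists2 b, centre T F b & ~ centre T E0 b.
Proof.
move=> TF cF; apply: contrapT => nex.
have [t Ft t0] := centre_nonzero TF.
suff e : (F : Y) = E0 by apply: excE; rewrite -e.
apply: (codim1_centre aT TE TF (gpoint_codim1 E0) _ Ft t0) => b Fb.
by apply: contrapT => nb; apply: nex; exists b.
Qed.

(* Off the finitely many non-exceptional primes where [t] vanishes, [b / t] is
   regular because [t] is invertible. *)
Lemma exceptional_pole : exists f, [/\ f != 0, ~ stalk (E0 : Y) f &
  forall F : pdiv Y, T F -> codim1 (mmap (F : Y)) -> stalk (F : Y) f].
Proof.
have [t Et t0] := centre_nonzero TE; have [mt Tt] := Et.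
have pE := affine_prime aT TE; have rT := sections_subring T.
(* The zeros of [t] are listed on [W], through a numerator [a]: noetherianity is at hand over [V],
   and a non-exceptional divisor has the local ring of its image. *)
have [a [c [Va Vc c0 tE]]] := affine_frac aV t.
have a0 : a != 0 by apply: contraNneq t0 => z; rewrite tE z mul0r.
have /finite_seqP[l lE] := finite_zeros aV nV Va a0.
have [b [Tb nEb lb]] : exists b, [/\ sections T b, ~ centre T E0 b &
    forall F : pdiv Y, T F -> codim1 (mmap (F : Y)) -> mmap (F : Y) \in l ->
      stalk (F : Y) (b / t)].
  elim: l {lE} => [|x l [b [Tb nEb lb]]].
    by exists 1; split => //; [exact: (subring1 rT)|exact: prime_not1 pE].
  have [[F [TF cF Fx]]|nex] := pselect (exists F : pdiv Y,
      [/\ T F, codim1 (mmap (F : Y)) & mmap (F : Y) = x]); last first.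
    exists b; split => // F TF cF; rewrite inE => /orP[/eqP Fx|]; last exact: lb.
    by case: nex; exists F.
  have [d [Fd Td] nEd] := separate TF cF.
  have dF := model_dvr F.
  have d0 := prime_neq0 pE nEd.
  (* [d] vanishes along [F], so its power with exponent the order of [t] makes up for the zero of
     [t]. *)
  have [k kE] : exists k : nat, ord (stalk (F : Y)) t = k%:Z.
    have := (ord_ge0 dF t0).1 (sections_stalk TF Tt).
    by case: (ord _ t) => // k _; exists k.
  have Fdt : stalk (F : Y) (d ^+ k / t).
    apply/(ord_ge0 dF); first by rewrite mulf_neq0 ?invr_eq0 ?expf_neq0.
    rewrite (ordM dF) ?invr_eq0 ?expf_neq0 // (ordV dF) // (ordX dF) // kE.
    by rewrite subr_ge0 ler_peMr // -gtz0_ge1; apply/(ord_gt0 dF).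
  exists (b * d ^+ k); split.
  - by apply: (subringM rT) => //; exact: (subringX rT).
  - apply: (prime_notM pE) => //; first exact: (subringX rT).
    by move=> /(primeX rT pE Td).
  - move=> G TG cG; have rG := stalk_subring (G : Y).
    rewrite inE => /orP[/eqP Gx|Gl].
      rewrite -mulrA; apply: (subringM rG); first exact: (sections_stalk TG).
      (* Non-exceptional divisors with the same image share their local ring, so one [F] for each
         point [x] suffices. *)
      rewrite -(codim1_image_stalk W_normal W_eft cG) Gx -Fx.
      by rewrite (codim1_image_stalk W_normal W_eft cF).
    rewrite mulrAC; apply: (subringM rG); first exact: lb.
    by apply: (subringX rG); exact: (sections_stalk TG).
have b0 := prime_neq0 pE nEb.
exists (b / t); split.
- by rewrite mulf_neq0 // invr_eq0.
(* Otherwise [b = (b / t) * t] would lie in the maximal ideal at [E0]. *)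
- move=> Ebt; apply: nEb; split => //.
  rewrite -(divfK t0 b); exact: (submodM (stalk_local _)).
- move=> F TF cF; have [|nl] := boolP (mmap (F : Y) \in l); first exact: lb.
  have rF := stalk_subring (F : Y); have sF := codim1_image_stalk W_normal W_eft cF.
  have VF : V (mmap (F : Y)) := TV TF.
  have Fa : stalk (F : Y) a by rewrite -sF; exact: (sections_stalk VF).
  apply: (subringM rF); first exact: (sections_stalk TF).
  have -> : t^-1 = c * a^-1 by rewrite tE invf_div.
  apply: (subringM rF); first by rewrite -sF; exact: (sections_stalk VF).
  have [[]//|ma] := unit_nonunits Fa.
  case/negP: nl; have : [set` l] (mmap (F : Y)) by rewrite -lE; split => //; rewrite sF.
  by [].
Qed.

End Exceptional.

(** Used contrapositively: along a divisor over [V] outside the locus, the section [s] vanishes, and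
    this compensates the poles of [f]. *)
Lemma nonvanishing_codim1 (Y : model W) (V : set W) (D : wdiv R Y) s (F : pdiv Y) :
  open V -> V (mmap (F : Y)) -> s != 0 ->
  div_sections D (@mmap K W Y @^-1` V) s ->
  (ord (stalk (F : Y)) s)%:~R + D F = 0 ->
  nonvanishing (@mmap K W Y) V D s (F : Y).
Proof.
move=> oV VF s0 hs e; split => //; have dF := model_dvr F.
apply/seteqP; split.
  move=> g [U [oU UF hg]]; have [->|g0] := eqVneq g 0.
    by exists 0; [exact: subring0 (stalk_subring _)|rewrite mulr0].
  exists (g / s); last by rewrite mulrC divfK.
  apply/(ord_ge0 dF); first by rewrite mulf_neq0 ?invr_eq0.
  rewrite (ordM dF) ?invr_eq0 // (ordV dF) // subr_ge0 -(ler_int R).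
  by have := div_sectionsP (E := F) g0 hg UF; rewrite -e lerD2r.
move=> _ [a Fa <-]; have [U [oU UF Ua]] := stalk_spread Fa.
have oV' := preimage_open (mmap_birational Y) oV.
exists (U `&` @mmap K W Y @^-1` V); split => //; first exact: openI.
have [->|a0] := eqVneq a 0; first by left; rewrite mulr0.
right => E [UE VE]; have dE := model_dvr E.
rewrite (ordM dE) // intrD addrAC addr_ge0 //; first exact: div_sectionsP hs VE.
by rewrite ler0z; apply/(ord_ge0 dE) => //; exact: Ua.
Qed.

(** Near [E] the sheaf [O(D)] is generated by the inverse of a local equation of [D], and two
    generators differ by a unit. *)
Lemma nonvanishing_ord (Y : model W) (V : set W) (D : wdiv R Y) s (E : pdiv Y) :
  cartier D -> div_sections D (@mmap K W Y @^-1` V) s ->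
  nonvanishing (@mmap K W Y) V D s (E : Y) ->
  s != 0 /\ (ord (stalk (E : Y)) s)%:~R + D E = 0.
Proof.
move=> cart hs [VE sE]; have dE := model_dvr E.
have [h [h0 [U [oU UE hU]]]] := cart (E : Y).
have : div_stalk D (E : Y) h^-1.
  exists U; split => //; right => F UF; rewrite (ordV (model_dvr F)) // hU //.
  by rewrite intrN addNr.
rewrite sE => -[a Ea ha].
have hi0 : h^-1 != 0 by rewrite invr_eq0.
have s0 : s != 0 by apply: contraNneq hi0 => z; rewrite -ha z mul0r.
have a0 : a != 0 by apply: contraNneq hi0 => z; rewrite -ha z mulr0.
split => //; apply/eqP; rewrite eq_le (div_sectionsP s0 hs VE) andbT.
rewrite (hU E UE) -intrD lerz0 -[ord _ h]opprK -(ordV dE) // -ha (ordM dE) //.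
by rewrite opprD addrA subrr sub0r oppr_le0; apply/(ord_ge0 dE).
Qed.

Lemma cartier_scale (Y : model W) (D : wdiv R Y) n : cartier D -> cartier (wscale n D).
Proof.
move=> cart y; have [h [h0 [U [oU Uy hU]]]] := cart y.
exists (h ^+ n); split; first by rewrite expf_neq0.
exists U; split => // F UF; rewrite (ordX (model_dvr F)) // intrM /wscale.
by rewrite (hU F UF).
Qed.

Lemma pushforward_iso_in_codim1 (Y : model W) : q_cartier_ample (@mmap K W Y) (KE Y) ->
  pluricanonical_pushforward W w -> iso_in_codim1 Y.
Proof.
move=> [m [m0 cart ample]] push E0 excE.
have [V [aV VE eV]] := ess_finite_stalk (mmap (E0 : Y)) W_eft.
have nV : noetherian (sections V).
  exact: ess_fin_noetherian (sections_subring V) eV.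
have oV := affine_is_open aV.
have [n [s [n0]]] := ample V aV E0 VE.
have cartN := cartier_scale n cart.
have scaleE (D : wdiv R Y) a b : wscale a (wscale b D) = wscale (a * b) D.
  by apply/funext => F; rewrite /wscale natrM mulrA.
rewrite !scaleE in cartN *; set N := (n * m)%N in cartN *.
have N0 : (0 < N)%N by rewrite muln_gt0 n0.
set D := wscale N (KE Y) in cartN * => hs nvE aT.
have [s0 sE] := nonvanishing_ord cartN hs nvE.
set T := nonvanishing _ _ _ _ in nvE aT.
have TV : T `<=` @mmap K W Y @^-1` V by move=> y [].
have [f [f0 nEf Tf]] := exceptional_pole aV nV aT TV nvE excE.
(* A denominator [c] over [V] bounds the pole orders of [f] along all prime divisors of [V] at once,
   by [k]. *)
have [a [c [Va Vc c0 fE]]] := affine_frac aV f.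
have a0 : a != 0 by apply: contraNneq f0 => z; rewrite fE z mul0r.
have [k kc] := bounded_ord aV nV Vc c0.
(* The exponent [k.+1] keeps the multiple [k.+1 * N] positive even when [k = 0]. *)
have g0 : s ^+ k.+1 * f != 0 by rewrite mulf_neq0 ?expf_neq0.
have : div_sections (wscale (k.+1 * N) KW) V (s ^+ k.+1 * f).
  right => F VF; have [F' [F'F sF]] := strict_transform W_normal W_eft Y F.
  have dF := base_dvr F.
  have VF' : V (mmap (F' : Y)) by rewrite F'F.
  have cF' : codim1 (mmap (F' : Y)) by rewrite F'F; exact: gpoint_codim1.
  have DF : D F' = N%:R * KW F.
    by rewrite /D /wscale /wadd exc_div_codim1 // addr0 /KW /canonical_div sF.
  rewrite (ordM dF) ?expf_neq0 // (ordX dF) // intrD intrM /wscale natrM.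
  have -> : k.+1%:Z%:~R * (ord (stalk (F : W)) s)%:~R + (ord (stalk (F : W)) f)%:~R
      + k.+1%:R * N%:R * KW F
    = k.+1%:R * ((ord (stalk (F' : Y)) s)%:~R + D F') + (ord (stalk (F : W)) f)%:~R :> R.
    by rewrite DF sF; ring.
  (* Either [s] generates at [F'], which then lies in [T], where [f] has no pole along such
     divisors; or [s] vanishes there, to order at least [1] because [D F'] is an integer. *)
  have [e|ne] := eqVneq ((ord (stalk (F' : Y)) s)%:~R + D F') 0.
    rewrite e mulr0 add0r ler0z; apply/(ord_ge0 dF) => //; rewrite -sF.
    apply: Tf => //; exact: nonvanishing_codim1.
  have e1 : 1 <= (ord (stalk (F' : Y)) s)%:~R + D F'.
    have := div_sectionsP (E := F') s0 hs VF'; move: ne.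
    rewrite DF /KW /canonical_div -[N%:R]/(N%:Z%:~R) -intrM -intrD intr_eq0 ler0z ler1z.
    by move=> ne ge; rewrite -gtz0_ge1 lt0r ne.
  have ef : - k%:R <= (ord (stalk (F : W)) f)%:~R :> R.
    rewrite fE (ordM dF) ?invr_eq0 // (ordV dF) // -[k%:R]/(k%:Z%:~R) -intrN ler_int.
    have := (ord_ge0 dF a0).1 (sections_stalk VF Va); have := kc F VF.
    lia.
  have := ler_wpM2l (ler0n R k.+1) e1; rewrite mulr1 -natr1; lra.
rewrite -(push Y (k.+1 * N)%N _ V oV); last by rewrite muln_gt0.
(* Along [E0] the generator [s] contributes [0], which leaves the order of [f] alone. *)
move=> hf; apply: nEf; have dE := model_dvr E0; apply/(ord_ge0 dE) => //.
have := div_sectionsP (E := E0) g0 hf VE.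
rewrite -scaleE -/D /wscale (ordM dE) ?expf_neq0 // (ordX dE) // intrD intrM.
by rewrite addrAC -mulrDr sE mulr0 add0r ler0z.
Qed.

End LogCanonicalModel.

Theorem theorem1p2 (R : realType) (K : fieldType)
    (iota : {rmorphism R[i] -> K}) (W : int_scheme K) (w : top_form iota)
    (W_normal : normal W) (W_eft : ess_finite_type iota W) :
  (valuative_lc W w <-> pluricanonical_pushforward W w) /\
  (forall Y : model W, log_canonical_model w Y ->
     (valuative_lc W w <-> iso_in_codim1 Y) /\
     (pluricanonical_pushforward W w <-> iso_in_codim1 Y)).
Proof.
have H := valuative_lc_pushforward w W_normal W_eft.
split=> // Y [_ amp lc].
have H' : pluricanonical_pushforward W w <-> iso_in_codim1 Y.
  split; first exact: pushforward_iso_in_codim1.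
  exact: iso_in_codim1_pushforward.
by split => //; rewrite H.
Qed.
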